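(* Not all tetrahedra with Dehn invariant zero tile space; that is, there exists a (non-degenerate) tetrahedron in $\mathbb{R}^3$ whose Dehn invariant is zero and which does not tile space.
   Context: For a tetrahedron with vertices labeled $1,2,3,4$, let $e_{ij}$ be the length of the edge $ij$ and $\alpha_{ij}$ the dihedral angle along it. The Dehn invariant is $$\mathcal{D}=\sum_{1\le i<j\le 4} e_{ij}\otimes\alpha_{ij}\in\mathbb{R}\otimes_{\mathbb{Q}}(\mathbb{R}/\mathbb{Q}\pi).$$ A polyhedron tiles space if one can place congruent copies of it (mirror images allowed) in $\mathbb{R}^3$ so that every point of $\mathbb{R}^3$ lies in the interior of exactly one copy or at the intersection of the boundaries of two or more copies. *)

(* Defs.v *)
From HB Require Import structures.
From mathcomp Require Import freeg.
From mathcomp Require Import all_boot all_order all_algebra.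
From mathcomp Require Import generic_quotient ring_quotient.
From mathcomp Require Import all_classical all_reals all_analysis.
Import Order.TTheory GRing.Theory Num.Theory.
Import numFieldNormedType.Exports.

Set Implicit Arguments.
Unset Strict Implicit.
Unset Printing Implicit Defensive.

Local Open Scope classical_set_scope.
Local Open Scope ring_scope.
Local Open Scope quotient_scope.

(* The tensor product of U and V over K, as an abelian group: the quotient of
   the free abelian group on U * V by the subgroup generated by the relations
   of biadditivity and K-balance *)
Section TensorProduct.
Variables (K : comNzRingType) (U V : lmodType K).

Local Notation free := {freeg (U * V)%type / int}.
Definition free_gen (u : U) (v : V) : free := Freeg [:: (1, (u, v))].

Inductive tensor_rel : free -> Prop :=
| tensor_relDl u u' v :
    tensor_rel (free_gen (u + u') v - free_gen u v - free_gen u' v)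
| tensor_relDr u v v' :
    tensor_rel (free_gen u (v + v') - free_gen u v - free_gen u v')
| tensor_relZ a u v :
    tensor_rel (free_gen (a *: u) v - free_gen u (a *: v))
| tensor_rel0 : tensor_rel 0
| tensor_relB w w' : tensor_rel w -> tensor_rel w' -> tensor_rel (w - w').

Definition tensor_ker : {pred free} := fun w => `[< tensor_rel w >].

Fact tensor_ker_zmod_closed : zmod_closed tensor_ker.
Proof.
split=> [|w w' /asboolP rw /asboolP rw']; apply/asboolP.
  exact: tensor_rel0.
exact: tensor_relB.
Qed.

HB.instance Definition _ :=
  GRing.isZmodClosed.Build free tensor_ker tensor_ker_zmod_closed.

Definition tensor : Type := {ideal_quot tensor_ker}.
HB.instance Definition _ := GRing.Zmodule.on tensor.

Definition tens (u : U) (v : V) : tensor :=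
  \pi_{ideal_quot tensor_ker} (free_gen u v).

Lemma tensDl u u' v : tens (u + u') v = tens u v + tens u' v.
Proof.
rewrite /tens -[RHS]raddfD; apply/eqP.
rewrite -Quotient.idealrBE; apply/asboolP; rewrite opprD addrA.
exact: tensor_relDl.
Qed.

Lemma tensDr u v v' : tens u (v + v') = tens u v + tens u v'.
Proof.
rewrite /tens -[RHS]raddfD; apply/eqP.
rewrite -Quotient.idealrBE; apply/asboolP; rewrite opprD addrA.
exact: tensor_relDr.
Qed.

Lemma tensZ a u v : tens (a *: u) v = tens u (a *: v).
Proof.
apply/eqP; rewrite -Quotient.idealrBE; apply/asboolP.
exact: tensor_relZ.
Qed.

End TensorProduct.

(* The Q-vector spaces R and R / Q pi *)

Definition ratmod (R : realType) : Type := R.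

Section RatModules.
Variable R : realType.

HB.instance Definition _ := GRing.Zmodule.on (ratmod R).

Definition ratmod_scale (q : rat) (x : ratmod R) : ratmod R :=
  (ratr q : R) * (x : R).

Fact ratmod_scaleA a b x :
  ratmod_scale a (ratmod_scale b x) = ratmod_scale (a * b) x.
Proof. by rewrite /ratmod_scale rmorphM /= mulrA. Qed.

Fact ratmod_scale1 : left_id 1 ratmod_scale.
Proof. by move=> x; rewrite /ratmod_scale rmorph1 mul1r. Qed.

Fact ratmod_scaleDr : right_distributive ratmod_scale +%R.
Proof. by move=> q x y; rewrite /ratmod_scale mulrDr. Qed.

Fact ratmod_scaleDl x : {morph ratmod_scale^~ x : a b / a + b}.
Proof. by move=> a b; rewrite /ratmod_scale rmorphD mulrDl. Qed.

HB.instance Definition _ := GRing.Zmodule_isLmodule.Build rat (ratmod R)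
  ratmod_scaleA ratmod_scale1 ratmod_scaleDr ratmod_scaleDl.

Definition Qpi : {pred ratmod R} :=
  fun x => `[< exists q : rat, x = q *: (trigo.pi : ratmod R) >].

Fact Qpi_zmod_closed : zmod_closed Qpi.
Proof.
split=> [|x y /asboolP[p ->] /asboolP[q ->]]; apply/asboolP.
  by exists 0; rewrite scale0r.
by exists (p - q); rewrite scalerBl.
Qed.

HB.instance Definition _ :=
  GRing.isZmodClosed.Build (ratmod R) Qpi Qpi_zmod_closed.

Definition modQpi : Type := {ideal_quot Qpi}.
HB.instance Definition _ := GRing.Zmodule.on modQpi.

Definition class_modQpi (x : R) : modQpi := \pi_{ideal_quot Qpi} (x : ratmod R).

Definition modQpi_scale (q : rat) (x : modQpi) : modQpi :=
  class_modQpi (q *: repr (x : {ideal_quot Qpi})).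

Fact modQpi_scaleE q (x : ratmod R) :
  modQpi_scale q (class_modQpi x) = class_modQpi (q *: x).
Proof.
apply/eqP; rewrite -Quotient.idealrBE -scalerBr.
have : repr (\pi_{ideal_quot Qpi} x) - x \in Qpi.
  by rewrite Quotient.idealrBE reprK.
move=> /asboolP[p ->]; apply/asboolP.
by exists (q * p); rewrite scalerA.
Qed.

Fact class_modQpiD (x y : ratmod R) :
  class_modQpi (x + y) = class_modQpi x + class_modQpi y.
Proof. exact: (raddfD (\pi_{ideal_quot Qpi})). Qed.

Fact class_modQpi_surj (x : modQpi) : exists y : ratmod R, x = class_modQpi y.
Proof. by exists (repr (x : {ideal_quot Qpi})); rewrite /class_modQpi reprK. Qed.

Fact modQpi_scaleA a b x :
  modQpi_scale a (modQpi_scale b x) = modQpi_scale (a * b) x.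
Proof.
by have [y ->] := class_modQpi_surj x; rewrite !modQpi_scaleE scalerA.
Qed.

Fact modQpi_scale1 : left_id 1 modQpi_scale.
Proof.
by move=> x; have [y ->] := class_modQpi_surj x; rewrite modQpi_scaleE scale1r.
Qed.

Fact modQpi_scaleDr : right_distributive modQpi_scale +%R.
Proof.
move=> q x x'; have [y ->] := class_modQpi_surj x.
have [y' ->] := class_modQpi_surj x'.
by rewrite -class_modQpiD !modQpi_scaleE scalerDr class_modQpiD.
Qed.

Fact modQpi_scaleDl x : {morph modQpi_scale^~ x : a b / a + b}.
Proof.
move=> a b; have [y ->] := class_modQpi_surj x.
by rewrite !modQpi_scaleE scalerDl class_modQpiD.
Qed.

HB.instance Definition _ := GRing.Zmodule_isLmodule.Build rat modQpi
  modQpi_scaleA modQpi_scale1 modQpi_scaleDr modQpi_scaleDl.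

End RatModules.

Section Geometry.
Variable R : realType.
Local Notation space := 'rV[R]_3.

Definition dotv (u v : space) : R := \sum_i u 0 i * v 0 i.

(* The norm `|u| that the library puts on 'rV[R]_3 is the sup norm, so the
   Euclidean one is defined separately; both induce the same topology. *)
Definition enorm (u : space) : R := Num.sqrt (dotv u u).

Definition edist (x y : space) : R := enorm (x - y).

Definition vangle (u v : space) : R := acos (dotv u v / (enorm u * enorm v)).

Definition orthopart (e u : space) : space := u - (dotv u e / dotv e e) *: e.

Definition nondegenerate_tetrahedron (v : 'I_4 -> space) : bool :=
  row_free (\matrix_(i < 3) (v (lift ord0 i) - v ord0)).

(* The solid tetrahedron, as the convex hull of its vertices *)
Definition tetrahedron (v : 'I_4 -> space) : set space :=
  [set x | exists t : 'I_4 -> R,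
     [/\ forall i, 0 <= t i, \sum_i t i = 1 & x = \sum_i t i *: v i]].

Definition edge_length (v : 'I_4 -> space) (i j : 'I_4) : R := edist (v i) (v j).

(* For i != j, the two vertices other than i and j *)
Definition other_vertices (i j : 'I_4) : 'I_4 * 'I_4 :=
  let s := [seq k <- enum 'I_4 | (k != i) && (k != j)] in
  (nth ord0 s 0, nth ord0 s 1).

(* The faces along the edge ij lie in the half-planes through the remaining
   vertices k and l; they make the angle of the components of v k - v i and
   v l - v i that are orthogonal to the edge. *)
Definition dihedral_angle (v : 'I_4 -> space) (i j : 'I_4) : R :=
  let k := (other_vertices i j).1 in
  let l := (other_vertices i j).2 in
  let e := v j - v i in
  vangle (orthopart e (v k - v i)) (orthopart e (v l - v i)).

Definition dehn_invariant (v : 'I_4 -> space) : tensor (ratmod R) (modQpi R) :=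
  \sum_(i < 4) \sum_(j < 4 | (i < j)%N)
    tens (edge_length v i j : ratmod R) (class_modQpi (dihedral_angle v i j)).

(* Distance-preserving maps include the orientation-reversing ones, so mirror
   images count as congruent. *)
Definition congruent (A B : set space) : Prop :=
  exists2 f : space -> space,
    (forall x y, edist (f x) (f y) = edist x y) & B = f @` A.

Definition boundary (A : set space) : set space := closure A `\` A°.

(* The two alternatives for a point x exclude each other: without the clause
   that no copy has x in its interior, the family of all congruent copies of P
   would count as a tiling. *)
Definition tiles_space (P : set space) : Prop :=
  exists C : set (set space),
    (forall A, C A -> congruent P A) /\
    forall x : space,
      (exists! A, C A /\ A° x) \/
      ((forall A, C A -> ~ A° x) /\
       exists A B, [/\ C A, C B, A <> B, boundary A x & boundary B x]).

End Geometry.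

(* Main.v *)
(* The tetrahedron has edges 423, 423, 364, 354, 305, 305 and dihedral angles
   al, al, be, ga, de, de along them.  The angles satisfy 2 al + be + 2 de = 2 pi
   and al + 3 ga - de = pi, which makes 423 al + 423 al + 364 be + 354 ga +
   305 de + 305 de a rational multiple of pi; since the lengths are integers the
   Dehn invariant vanishes.
   In a tiling, consider the tiles around a generic point of the edge with angle
   ga: each of them is locally a half-space or a wedge around the line of that
   edge, so ga and further terms among al, be, ga, de, pi must add up to 2 pi.
   The four dihedral angles lie between pi/3 and pi/2, hence there would be exactly
   five of them in the sum.  But exp(i al), ..., exp(i de) are positive multiples of
   Gaussian integers, and no product of five of these that involves ga is real:
   its imaginary part is nonzero modulo 31. *)

Require Import Defs.
From mathcomp Require Import all_boot all_order all_algebra.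
From mathcomp Require Import all_classical all_reals all_analysis.
From mathcomp Require Import ring lra.
Import Order.TTheory GRing.Theory Num.Theory.
Import numFieldNormedType.Exports.

Set Implicit Arguments.
Unset Strict Implicit.
Unset Printing Implicit Defensive.

Local Open Scope ring_scope.

(** * Polar coordinates and arguments of complex numbers *)

Section Angles.
Variable R : realType.
Implicit Types x y s t : R.

Lemma sin_2pi t : sin (t + 2 * pi) = sin t.
Proof. by rewrite mulr_natl sinD2pi. Qed.

Lemma sin_pi t : sin (t + pi) = - sin t.
Proof. exact: sinDpi. Qed.

Lemma polar x y : (x != 0) || (y != 0) ->
  exists r s, [/\ 0 < r, 0 <= s < 2 * pi, x = r * cos s & y = r * sin s].
Proof.
move=> xy0; have pi0 := @pi_gt0 R.
have q0 : 0 < x ^+ 2 + y ^+ 2.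
  rewrite lt0r paddr_eq0 ?sqr_ge0 // !expf_eq0 /= negb_and xy0.
  by rewrite addr_ge0 ?sqr_ge0.
set r := Num.sqrt (x ^+ 2 + y ^+ 2).
have r0 : 0 < r by rewrite sqrtr_gt0.
have rE : r ^+ 2 = x ^+ 2 + y ^+ 2 by rewrite sqr_sqrtr // ltW.
have c1 : -1 <= x / r <= 1.
  rewrite -ler_norml -ler_sqr ?nnegrE // expr1n real_normK ?num_real //.
  rewrite expr_div_n rE ler_pdivrMr // mul1r; have := sqr_ge0 y; lra.
have cE : cos (acos (x / r)) = x / r by rewrite acosK // in_itv.
have sE : sin (acos (x / r)) = `|y| / r.
  have yr0 : 0 <= `|y| / r by rewrite divr_ge0 // ltW.
  rewrite sin_acos // -[RHS]ger0_norm // -sqrtr_sqr.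
  congr Num.sqrt; rewrite !expr_div_n rE real_normK ?num_real //.
  by field; rewrite gt_eqF.
have [y0|y0] := leP 0 y.
  exists r; exists (acos (x / r)); split=> //.
  - by rewrite acos_ge0 //=; have := acos_lepi c1; lra.
  - by rewrite cE mulrC divfK // gt_eqF.
  - by rewrite sE ger0_norm // mulrC divfK // gt_eqF.
exists r; exists (2 * pi - acos (x / r)); split=> //.
- have a1 := acos_lepi c1; apply/andP; split; first lra.
  (* The strict bound [s < 2 * pi] requires a nonzero arccosine, which [y < 0] provides through the
     sine. *)
  have : acos (x / r) != 0; last by have := acos_ge0 c1; lra.
  apply/eqP => a0; move: sE; rewrite a0 sin0 => /esym/eqP.
  by rewrite mulf_eq0 normr_eq0 invr_eq0 (lt_eqF y0) (gt_eqF r0).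
- rewrite mulr_natl cosB cos2pi sin2pi mul1r mul0r addr0 cE mulrC divfK //.
  by rewrite gt_eqF.
- rewrite mulr_natl sinB cos2pi sin2pi mul1r mul0r add0r sE ltr0_norm //.
  by rewrite mulNr opprK mulrC divfK // gt_eqF.
Qed.

Lemma polar_from (s0 : R) x y : (x != 0) || (y != 0) ->
  exists r s, [/\ 0 < r, s0 <= s < s0 + 2 * pi, x = r * cos s & y = r * sin s].
Proof.
move=> xy0; have c2 := cos2Dsin2 s0.
(* Rotating by [- s0] moves the window of angles that starts at [s0] to the one that starts at
   [0]. *)
pose x' := x * cos s0 + y * sin s0; pose y' := y * cos s0 - x * sin s0.
have xE : x = x' * cos s0 - y' * sin s0.
  by rewrite -[LHS]mulr1 -c2 /x' /y'; ring.
have yE : y = x' * sin s0 + y' * cos s0.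
  by rewrite -[LHS]mulr1 -c2 /x' /y'; ring.
have [|r [s [r0 /andP[s1 s2] x'E y'E]]] := @polar x' y'.
  rewrite -negb_and; apply: contraL xy0 => /andP[/eqP x0 /eqP y0].
  by rewrite xE yE x0 y0 !mul0r subrr addr0 eqxx.
exists r; exists (s0 + s); split=> //; first by apply/andP; split; lra.
  by rewrite cosD xE x'E y'E; ring.
by rewrite sinD yE x'E y'E; ring.
Qed.

(* t is an argument of the complex number x + i y. *)
Definition gauss_arg t x y := exists2 r, 0 < r & r * cos t = x /\ r * sin t = y.

Lemma gauss_argD t t' x y x' y' : gauss_arg t x y -> gauss_arg t' x' y' ->
  gauss_arg (t + t') (x * x' - y * y') (x * y' + y * x').
Proof.
move=> [r r0 [<- <-]] [r' r'0 [<- <-]]; exists (r * r'); first exact: mulr_gt0.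
by split; rewrite ?cosD ?sinD; ring.
Qed.

Lemma gauss_argN t x y : gauss_arg t x y -> gauss_arg (- t) x (- y).
Proof. by move=> [r r0 [<- <-]]; exists r => //; rewrite cosN sinN mulrN. Qed.

Lemma gauss_arg_sin0 t x y : gauss_arg t x y -> sin t = 0 -> y = 0.
Proof. by move=> [r _ [_ <-]] ->; rewrite mulr0. Qed.

(** Turns the vanishing of an imaginary part into an exact angle identity: [sin (t - k)] is positive
    before [k + pi] and negative after it, within the given window. *)
Lemma sin0_eq (k : R) t : k < t < k + 2 * pi -> sin t = 0 -> sin k = 0 ->
  t = k + pi.
Proof.
move=> /andP[t0 t2] st sk.
have s0 : sin (t - k) = 0 by rewrite sinB st sk mul0r mulr0 subrr.
have [tpi|tpi|] := ltgtP (t - k) pi; last by lra.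
  by have := @sin_gt0_pi R (t - k); rewrite tpi s0 ltxx subr_gt0 t0 => /(_ isT).
have : 0 < sin (t - k - pi) by apply: sin_gt0_pi; apply/andP; split; lra.
by rewrite (sinB (t - k)) s0 mul0r sinpi mulr0 subrr ltxx.
Qed.

End Angles.

(* Arcs of the circle of angles, of which the first one is [s i0, s i0 + th i0]; when
   they tile the circle, walking from each arc to the next one adds up to a full
   turn.  Membership in an arc is expressed by the signs of two sines. *)
Section ArcChain.
Local Open Scope classical_set_scope.
Local Open Scope ring_scope.
Variables (R : realType) (I : Type) (K : finType) (F : K -> I).
Variables (N : I -> Prop) (s th : I -> R) (cl op : I -> R -> Prop).
Variables (i0 : I) (low : R).
Local Notation a := (s i0).
Local Notation g := (th i0).
Hypothesis Ni0 : N i0.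
Hypothesis low0 : 0 < low.
Hypothesis s_range : forall i, N i -> a <= s i < a + 2 * pi.
Hypothesis th_range : forall i, N i -> low <= th i <= pi.
Hypothesis cover : forall phi, exists k, N (F k) /\ cl (F k) phi.
Hypothesis clP : forall i phi, N i -> cl i phi ->
  0 <= sin (phi - s i) /\ 0 <= sin (s i + th i - phi).
Hypothesis opP : forall i phi, N i -> 0 < sin (phi - s i) ->
  0 < sin (s i + th i - phi) -> op i phi.
Hypothesis disj : forall i j phi, N i -> N j -> op i phi -> op j phi -> i = j.

Lemma sin_lt0_pi2 (t : R) : pi < t < 2 * pi -> sin t < 0.
Proof.
move=> /andP[t1 t2]; have : 0 < sin (t - pi).
  by apply: sin_gt0_pi; apply/andP; split; lra.
by rewrite sinB cospi sinpi mulr0 subr0 mulrN1 oppr_gt0.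
Qed.

Lemma op_inside i phi : N i -> s i < phi < s i + th i -> op i phi.
Proof.
have low_gt0 := low0; have pi0 := @pi_gt0 R.
move=> Ni /andP[p1 p2]; have /andP[t1 t2] := th_range Ni.
by apply: opP => //; apply: sin_gt0_pi; apply/andP; split; lra.
Qed.

(** An arc that starts before the first one ends, or that runs past a full turn, would share an
    interior angle with the first arc, against [disj]. *)
Lemma arc_after i : N i -> i <> i0 ->
  a + g <= s i /\ s i + th i <= a + 2 * pi.
Proof.
have low_gt0 := low0; have pi0 := @pi_gt0 R.
move=> Ni ii0; have /andP[s1 s2] := s_range Ni.
have /andP[t1 t2] := th_range Ni; have /andP[g1 g2] := th_range Ni0.
split; rewrite leNgt; apply/negP => lt1; apply: ii0.
  pose m : R := Num.min (s i + th i) (a + g).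
  have [m1 m2] : s i < m /\ m <= a + g.
    by split; [rewrite lt_min lt1 andbT; lra | rewrite ge_min lexx orbT].
  have m3 : m <= s i + th i by rewrite ge_min lexx.
  by apply: (@disj _ _ ((s i + m) / 2)) => //; apply: op_inside => //;
    apply/andP; split; lra.
(* The arc overshoots [a + 2 * pi]; half of the overshoot, capped by [g], gives an angle [a + m / 2]
   interior to both arcs after a shift by a full turn. *)
pose m : R := Num.min g (s i + th i - a - 2 * pi).
have m0 : 0 < m by rewrite lt_min; apply/andP; split; lra.
have m1 : m <= g by rewrite ge_min lexx.
have m2 : m <= s i + th i - a - 2 * pi by rewrite ge_min lexx orbT.
apply: (@disj _ _ (a + m / 2)) => //; last first.
  by apply: op_inside => //; apply/andP; split; lra.
apply: opP => //.
  rewrite -sin_2pi; apply: sin_gt0_pi; apply/andP; split; lra.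
have -> : s i + th i - (a + m / 2) =
  s i + th i - (a + m / 2) - 2 * pi + 2 * pi by ring.
rewrite sin_2pi; apply: sin_gt0_pi; apply/andP; split; lra.
Qed.

(** Sine signs determine [phi] only modulo [2 * pi]. Here the arc and [phi] lie in one window of
    that length, and outside the arc one of the two sines is negative. *)
Lemma cl_inside i phi : N i -> i <> i0 -> a < phi < a + 2 * pi -> cl i phi ->
  s i <= phi <= s i + th i.
Proof.
have low_gt0 := low0; have pi0 := @pi_gt0 R.
move=> Ni ii0 /andP[p1 p2] /(clP Ni)[c1 c2].
have /andP[t1 t2] := th_range Ni; have /andP[g1 g2] := th_range Ni0.
have [s1 s2] := arc_after Ni ii0.
apply/andP; split; rewrite leNgt; apply/negP => lt1.
  have q1 : phi - s i <= - pi.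
    rewrite leNgt; apply/negP => q1; move: c1; rewrite leNgt => /negP; apply.
    by rewrite -sin_2pi; apply: sin_lt0_pi2; apply/andP; split; lra.
  move: c2; rewrite leNgt => /negP; apply; apply: sin_lt0_pi2.
  by apply/andP; split; lra.
have q1 : pi <= phi - (s i + th i).
  rewrite leNgt; apply/negP => q1; move: c2; rewrite leNgt => /negP; apply.
  by rewrite -sin_2pi; apply: sin_lt0_pi2; apply/andP; split; lra.
move: c1; rewrite leNgt => /negP; apply; apply: sin_lt0_pi2.
by apply/andP; split; lra.
Qed.

Lemma cl_first phi : a + g < phi < a + 2 * pi -> ~ cl i0 phi.
Proof.
have low_gt0 := low0; have pi0 := @pi_gt0 R.
move=> /andP[p1 p2] /(clP Ni0)[c1 c2]; have /andP[g1 g2] := th_range Ni0.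
have q1 : pi <= phi - (a + g).
  rewrite leNgt; apply/negP => q1; move: c2; rewrite leNgt => /negP; apply.
  by rewrite -sin_2pi; apply: sin_lt0_pi2; apply/andP; split; lra.
move: c1; rewrite leNgt => /negP; apply; apply: sin_lt0_pi2.
by apply/andP; split; lra.
Qed.

(** Otherwise every [F k] misses [e + h] for all small [h > 0]: an arc that starts after [e] has not
    begun yet, and one that starts before [e] has ended by [e], as it would overlap arc [j].
    Finiteness of [K] gives a common [h], against [cover]. *)
Lemma arc_next j : N j -> s j + th j < a + 2 * pi ->
  exists i, [/\ N i, i <> i0 & s i = s j + th j].
Proof.
have low_gt0 := low0; have pi0 := @pi_gt0 R.
move=> Nj; set e := s j + th j => e2.
have /andP[tj1 tj2] := th_range Nj; have /andP[g1 g2] := th_range Ni0.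
have e1 : a + g <= e.
  by rewrite /e; have [->|/(arc_after Nj)[]] := pselect (j = i0); lra.
apply: contrapT => noi.
have away k : \forall h \near (0 : R)^'+, ~ (N (F k) /\ cl (F k) (e + h)).
  have h0 := nbhs_right_gt (0 : R).
  have h1 : \forall h \near (0 : R)^'+, h < a + 2 * pi - e.
    by apply: nbhs_right_lt; rewrite subr_gt0.
  have [Nk|Nk] := pselect (N (F k)); last by near=> h; case.
  have [Fk|Fk] := pselect (F k = i0).
    near=> h; case=> _; rewrite Fk; apply: cl_first; apply/andP; split.
      by rewrite (le_lt_trans e1) // ltrDl; near: h.
    by rewrite -ltrBrDl; near: h.
  have [sk1 sk2] := arc_after Nk Fk; have /andP[tk1 tk2] := th_range Nk.
  have inside h : 0 < h -> h < a + 2 * pi - e -> cl (F k) (e + h) ->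
      s (F k) <= e + h <= s (F k) + th (F k).
    by move=> hh1 hh2; apply: cl_inside => //; apply/andP; split; lra.
  have [ske|ske|ske] := ltgtP (s (F k)) e; last by case: noi; exists (F k).
    have tke : s (F k) + th (F k) <= e.
      rewrite leNgt; apply/negP => lt1.
      (* From the later of the two starts up to [e], both arcs are present, so their midpoint lies
         in both. *)
      pose m : R := Num.max (s (F k)) (s j).
      have m1 : s (F k) <= m by rewrite le_max lexx.
      have m2 : s j <= m by rewrite le_max lexx orbT.
      have m3 : m < e by rewrite gt_max ske /e; lra.
      have Fkj : F k = j.
        by apply: (@disj _ _ ((m + e) / 2)) => //; apply: op_inside => //;
          rewrite -/e; apply/andP; split; lra.
      by move: lt1; rewrite Fkj ltxx.
    near=> h; case=> _ /inside; case/(_ _ _)/andP; [by near: h|by near: h|].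
    move=> _; apply/negP; rewrite -ltNge (le_lt_trans tke) // ltrDl.
    by near: h.
  near=> h; case=> _ /inside; case/(_ _ _)/andP; [by near: h|by near: h|].
  move=> + _; apply/negP; rewrite -ltNge -ltrBrDl.
  by near: h; apply: nbhs_right_lt; rewrite subr_gt0.
have /filter_ex[h hk] : \forall h \near (0 : R)^'+,
    forall k, ~ (N (F k) /\ cl (F k) (e + h)) by exact: filter_forall away.
by have [k] := cover (e + h); exact: hk.
Unshelve. all: by end_near. Qed.

(** The number [n] is fuel: each arc consumes at least [low] of the angle that remains. *)
Lemma arc_chain_from n j : N j -> a + 2 * pi - (s j + th j) < n%:R * low ->
  exists2 l : seq R, (forall x, x \in l -> exists2 i, N i & th i = x) &
    s j + th j + \sum_(x <- l) x = a + 2 * pi.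
Proof.
have low_gt0 := low0; have pi0 := @pi_gt0 R.
elim: n j => [|n IHn] j Nj.
  rewrite mul0r => lt0; have : s j + th j <= a + 2 * pi; last lra.
  have [->|/(arc_after Nj)[//]] := pselect (j = i0).
  by have /andP[g1 g2] := th_range Ni0; lra.
have [lt1|ge1] := ltP (s j + th j) (a + 2 * pi); last first.
  move=> _; exists [::] => //; rewrite big_nil addr0; apply/eqP.
  rewrite eq_le ge1 andbT.
  have [->|/(arc_after Nj)[//]] := pselect (j = i0).
  by have /andP[g1 g2] := th_range Ni0; lra.
rewrite (_ : n.+1%:R * low = n%:R * low + low) => [ltn|]; last first.
  by rewrite -natr1 mulrDl mul1r.
have [i [Ni ii0 si]] := arc_next Nj lt1.
have /andP[t1 t2] := th_range Ni.
have [|l lP lE] := IHn i Ni; first by rewrite si; lra.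
exists (th i :: l); last by move: lE; rewrite big_cons si addrA.
by move=> x; rewrite inE => /predU1P[->|/lP//]; exists i.
Qed.

Lemma arc_chain :
  exists2 l : seq R, (forall x, x \in l -> exists2 i, N i & th i = x) &
    g + \sum_(x <- l) x = 2 * pi.
Proof.
have low_gt0 := low0; have pi0 := @pi_gt0 R.
have [|l lP lE] := @arc_chain_from (Num.truncn (2 * pi / low)).+1 i0 Ni0.
  have /andP[g1 g2] := th_range Ni0.
  have : 2 * pi < (Num.truncn (2 * pi / low)).+1%:R * low; last lra.
  rewrite -ltr_pdivrMr //; exact: truncnS_gt.
by exists l => //; lra.
Qed.

End ArcChain.

(** * The four dihedral angles, their linear relations and the sums of angles around an edge *)

Section TheAngles.
Variable R : realType.
Implicit Types x y s t : R.

(** For [0 < y], this is the argument of [x + i y] between [0] and [pi]; the arccosine form agrees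
    with [vangle]. *)
Definition gauss_angle x y : R := acos (x / Num.sqrt (x ^+ 2 + y ^+ 2)).

Lemma gauss_ratio_itv x y : 0 < y -> -1 <= x / Num.sqrt (x ^+ 2 + y ^+ 2) <= 1.
Proof.
move=> y0; have q0 : 0 < x ^+ 2 + y ^+ 2 by nra.
rewrite -ler_norml -ler_sqr ?nnegrE // expr1n real_normK ?num_real //.
rewrite expr_div_n sqr_sqrtr; last exact: ltW.
by rewrite ler_pdivrMr // mul1r; nra.
Qed.

Lemma gauss_angleP x y : 0 < y -> gauss_arg (gauss_angle x y) x y.
Proof.
move=> y0; rewrite /gauss_angle; set q := x ^+ 2 + y ^+ 2; set r := Num.sqrt q.
have q0 : 0 < q by rewrite /q; nra.
have r0 : 0 < r by rewrite sqrtr_gt0.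
have rE : r ^+ 2 = q by rewrite sqr_sqrtr // ltW.
have c1 : -1 <= x / r <= 1 by exact: gauss_ratio_itv.
exists r => //; rewrite acosK ?in_itv // sin_acos //; split.
  by rewrite mulrC divfK // gt_eqF.
have -> : 1 - (x / r) ^+ 2 = (y / r) ^+ 2.
  by rewrite !expr_div_n rE /q; field; rewrite gt_eqF.
by rewrite sqrtr_sqr ger0_norm ?divr_ge0 ?ltW // mulrC divfK // gt_eqF.
Qed.

Lemma gauss_angle_itv x y : 0 < x -> 3 * x ^+ 2 < y ^+ 2 -> 0 < y ->
  pi / 3 < gauss_angle x y < pi / 2.
Proof.
move=> x0 xy y0; have pi0 := @pi_gt0 R; have zP := gauss_angleP x y0.
have c1 := gauss_ratio_itv x y0.
have := acos_lepi c1; have := acos_ge0 c1; rewrite -/(gauss_angle x y).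
move: (gauss_angle x y) zP => t zP t0 tpi; apply/andP; split; rewrite ltNge.
  (* The imaginary part of [(x + i y) ^ 3] is [y * (3 * x ^ 2 - y ^ 2) < 0], whereas [t <= pi / 3]
     would make it nonnegative. *)
  apply/negP => t3; have [r r0 [_]] := gauss_argD (gauss_argD zP zP) zP.
  have : 0 <= sin (t + t + t).
    by apply: sin_ge0_pi; apply/andP; split; lra.
  move=> s0; have : 0 <= r * sin (t + t + t) by rewrite mulr_ge0 // ltW.
  by move=> /[swap] -> ; nra.
apply/negP => t3; have [r r0 [xE _]] := zP.
have : 0 <= sin (t - pi / 2) by apply: sin_ge0_pi; apply/andP; split; lra.
by rewrite sinBpihalf; nra.
Qed.

(* The dihedral angles of the tetrahedron, as arguments of Gaussian integers. *)
Definition al : R := gauss_angle 295 564.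
Definition be : R := gauss_angle 2919 9440.
Definition ga : R := gauss_angle 40 91.
Definition de : R := gauss_angle 236 1525.

Lemma al_itv : pi / 3 < al < pi / 2. Proof. by apply: gauss_angle_itv; lra. Qed.
Lemma be_itv : pi / 3 < be < pi / 2. Proof. by apply: gauss_angle_itv; lra. Qed.
Lemma ga_itv : pi / 3 < ga < pi / 2. Proof. by apply: gauss_angle_itv; lra. Qed.
Lemma de_itv : pi / 3 < de < pi / 2. Proof. by apply: gauss_angle_itv; lra. Qed.

Lemma al_arg : gauss_arg al 295 564. Proof. by apply: gauss_angleP; lra. Qed.
Lemma be_arg : gauss_arg be 2919 9440. Proof. by apply: gauss_angleP; lra. Qed.
Lemma ga_arg : gauss_arg ga 40 91. Proof. by apply: gauss_angleP; lra. Qed.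
Lemma de_arg : gauss_arg de 236 1525. Proof. by apply: gauss_angleP; lra. Qed.

Lemma sin_2pi0 : sin (2 * pi) = 0 :> R. Proof. by rewrite mulr_natl sin2pi. Qed.

Lemma gauss_arg_scale t k x y : 0 < k ->
  gauss_arg t (k * x) (k * y) -> gauss_arg t x y.
Proof.
move=> k0 [r r0 [cE sE]]; exists (r / k); first exact: divr_gt0.
by split; rewrite mulrAC ?cE ?sE mulrC mulKf ?gt_eqF.
Qed.

Lemma al_de_arg : gauss_arg (al + de) (- 80) 59.
Proof.
(* [9881 = 41 * 241] is the common factor of both parts of [(295 + 564 i) * (236 + 1525 i)]. *)
apply: (@gauss_arg_scale _ 9881); first lra.
have := gauss_argD al_arg de_arg; congr gauss_arg; ring.
Qed.

(** The square of [- 80 + 59 i] is [2919 - 9440 i], the conjugate of the number for [be], so the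
    product is real; the bounds on the angles single out [2 * pi]. Relations are to be expected: the
    norms of all four numbers are products of powers of 41 and 241. *)
Lemma angle_relation1 : 2 * al + be + 2 * de = 2 * pi.
Proof.
have [r r0 [_ /esym]] := gauss_argD (gauss_argD al_de_arg al_de_arg) be_arg.
rewrite (_ : _ + _ * _ = 0); last by ring.
have {r0} rn0 : r != 0 by rewrite gt_eqF.
move=> /esym/eqP; rewrite mulf_eq0 (negbTE rn0) /= => /eqP s0.
have /andP[a1 a2] := al_itv; have /andP[b1 b2] := be_itv.
have /andP[d1 d2] := de_itv; have pi0 := @pi_gt0 R.
suff : al + de + (al + de) + be = pi + pi by lra.
by apply: sin0_eq; rewrite ?sinpi //; apply/andP; split; lra.
Qed.

(** The product [(295 + 564 i) * (236 - 1525 i) * (40 + 91 i) ^ 3] is real, and its argument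
    computed from the angles lies strictly between [0] and [2 * pi]. *)
Lemma angle_relation2 : al + 3 * ga - de = pi.
Proof.
have [r r0 [_ /esym]] := gauss_argD (gauss_argD al_arg (gauss_argN de_arg))
  (gauss_argD ga_arg (gauss_argD ga_arg ga_arg)).
rewrite (_ : _ + _ * _ = 0); last by ring.
have {r0} rn0 : r != 0 by rewrite gt_eqF.
move=> /esym/eqP; rewrite mulf_eq0 (negbTE rn0) /= => /eqP s0.
have /andP[a1 a2] := al_itv; have /andP[c1 c2] := ga_itv.
have /andP[d1 d2] := de_itv; have pi0 := @pi_gt0 R.
suff : al + - de + (ga + (ga + ga)) = 0 + pi by lra.
by apply: sin0_eq; rewrite ?sin0 //; apply/andP; split; lra.
Qed.

(** Multiplication of Gaussian integers modulo 31, as pairs of real and imaginary parts. An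
    imaginary part that is nonzero modulo 31 is nonzero, so a finite computation suffices. *)
Definition gauss31_mul (z w : 'F_31 * 'F_31) : 'F_31 * 'F_31 :=
  (z.1 * w.1 - z.2 * w.2, z.1 * w.2 + z.2 * w.1).

Definition gauss31_arg t (z : 'F_31 * 'F_31) := exists2 w : int * int,
  gauss_arg t w.1%:~R w.2%:~R & z = (w.1%:~R, w.2%:~R).

Lemma gauss31_argD t t' z z' : gauss31_arg t z -> gauss31_arg t' z' ->
  gauss31_arg (t + t') (gauss31_mul z z').
Proof.
move=> [[m n] /= mnP ->] [[m' n'] /= mnP' ->].
exists (m * m' - n * n', m * n' + n * m').
  by rewrite /= rmorphB rmorphD !rmorphM; exact: gauss_argD.
by rewrite /gauss31_mul /= rmorphB rmorphD !rmorphM.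
Qed.

Lemma gauss31_arg_sin t z : gauss31_arg t z -> z.2 != 0 -> sin t <> 0.
Proof.
by move=> [w wP ->] /= n0 /(gauss_arg_sin0 wP)/eqP; rewrite intr_eq0;
  apply/negP; apply: contra n0 => /eqP->.
Qed.

(* The residues modulo 31 of the Gaussian integers with arguments al, be, ga, de. *)
Definition gauss31_units : seq ('F_31 * 'F_31) :=
  [:: (16, 6); (5, 16); (9, 29); (19, 6)].

Definition edge_angle t := t \in [:: al; be; ga; de].

Lemma gauss31_arg_nat t (m n : nat) z : gauss_arg t m%:R n%:R ->
  (m%:R == z.1) && (n%:R == z.2) -> gauss31_arg t z.
Proof.
case: z => z1 z2 /= mnP /andP[/eqP <- /eqP <-].
by exists (m%:Z, n%:Z); rewrite /= -?pmulrn.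
Qed.

Lemma edge_angle31 t : edge_angle t -> exists2 z, z \in gauss31_units & gauss31_arg t z.
Proof.
rewrite /edge_angle !inE => /or4P[] /eqP->.
- exists (16, 6); first by vm_compute.
  by apply: (@gauss31_arg_nat _ 295 564); [exact: al_arg|vm_compute].
- exists (5, 16); first by vm_compute.
  by apply: (@gauss31_arg_nat _ 2919 9440); [exact: be_arg|vm_compute].
- exists (9, 29); first by vm_compute.
  by apply: (@gauss31_arg_nat _ 40 91); [exact: ga_arg|vm_compute].
- exists (19, 6); first by vm_compute.
  by apply: (@gauss31_arg_nat _ 236 1525); [exact: de_arg|vm_compute].
Qed.

(** An exhaustive check of 256 products; the fixed factor [(9, 29)] is the residue of [40 + 91 i],
    since [ga] must occur. *)
Lemma gauss31_check :
  all (fun a => all (fun b => all (fun c => all (fun d =>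
    (gauss31_mul (gauss31_mul (gauss31_mul (gauss31_mul (9, 29) a) b) c) d).2
      != 0) gauss31_units) gauss31_units) gauss31_units) gauss31_units.
Proof. by vm_compute. Qed.

Lemma edge_angle_itv t : edge_angle t -> pi / 3 < t < pi / 2.
Proof.
rewrite /edge_angle !inE => /or4P[] /eqP->.
- exact: al_itv.
- exact: be_itv.
- exact: ga_itv.
- exact: de_itv.
Qed.

Lemma five_angles a b c d : edge_angle a -> edge_angle b -> edge_angle c ->
  edge_angle d -> ga + a + b + c + d <> 2 * pi.
Proof.
move=> /edge_angle31[a' aU aP] /edge_angle31[b' bU bP].
move=> /edge_angle31[c' cU cP] /edge_angle31[d' dU dP] sum2pi.
have gP : gauss31_arg ga (9, 29).
  by apply: (@gauss31_arg_nat _ 40 91); [exact: ga_arg|vm_compute].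
have := allP (allP (allP (allP gauss31_check _ aU) _ bU) _ cU) _ dU.
move=> n0; apply: (gauss31_arg_sin _ n0 sin_2pi0); rewrite -sum2pi.
exact: gauss31_argD (gauss31_argD (gauss31_argD (gauss31_argD gP aP) bP) cP) dP.
Qed.

(** Case analysis on the number of terms besides [ga]. With at most two, the sum is below [2 * pi]
    unless both are [pi]; with three, it is below without a [pi] and above with one; with four, a
    [pi] is too much and [five_angles] treats the rest; with five or more, all terms exceed
    [pi / 3]. *)
Lemma angle_sum_neq (l : seq R) :
  (forall t, t \in l -> edge_angle t \/ t = pi) -> ga + \sum_(t <- l) t <> 2 * pi.
Proof.
have pi0 := @pi_gt0 R; have /andP[g1 g2] := ga_itv.
have low t : edge_angle t \/ t = pi -> pi / 3 < t <= pi.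
  by case=> [/edge_angle_itv/andP[t1 t2]|->]; apply/andP; split; lra.
case: l => [|a [|b [|c [|d [|e l]]]]] lP; rewrite ?big_cons ?big_nil.
- lra.
- have /low/andP[a1 a2] := lP a (mem_head _ _); lra.
- have [] := (lP a, lP b); rewrite !inE !eqxx ?orbT.
  move=> /(_ isT)[/edge_angle_itv/andP[a1 a2]|->];
  by move=> /(_ isT)[/edge_angle_itv/andP[b1 b2]|->]; lra.
- have [[]] := (lP a, lP b, lP c); rewrite !inE !eqxx ?orbT.
  move=> /(_ isT)[/edge_angle_itv/andP[a1 a2]|->];
  move=> /(_ isT)[/edge_angle_itv/andP[b1 b2]|->];
  by move=> /(_ isT)[/edge_angle_itv/andP[c1 c2]|->]; lra.
- have [[[]]] := (lP a, lP b, lP c, lP d); rewrite !inE !eqxx ?orbT.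
  move=> /(_ isT) aP /(_ isT) bP /(_ isT) cP /(_ isT) dP.
  have /andP[a1 _] := low _ aP; have /andP[b1 _] := low _ bP.
  have /andP[c1 _] := low _ cP; have /andP[d1 _] := low _ dP.
  case: aP => [aP|ae]; last lra.
  case: bP => [bP|bE]; last lra.
  case: cP => [cP|cE]; last lra.
  case: dP => [dP|dE]; last lra.
  by rewrite addr0 !addrA; exact: five_angles.
have /low/andP[a1 _] := lP a (mem_head _ _).
have [[[]]] := (lP b, lP c, lP d, lP e); rewrite !inE !eqxx ?orbT.
move=> /(_ isT)/low/andP[b1 _] /(_ isT)/low/andP[c1 _] /(_ isT)/low/andP[d1 _].
move=> /(_ isT)/low/andP[e1 _].
have : 0 <= \sum_(t <- l) t; last lra.
rewrite big_seq; apply: sumr_ge0 => t tl.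
have /low/andP[t1 _] : edge_angle t \/ t = pi by apply: lP; rewrite !inE tl !orbT.
by lra.
Qed.

End TheAngles.

Local Notation c0 := (@Ordinal 3 0 isT).
Local Notation c1 := (@Ordinal 3 1 isT).
Local Notation c2 := (@Ordinal 3 2 isT).
Local Notation k0 := (@Ordinal 4 0 isT).
Local Notation k1 := (@Ordinal 4 1 isT).
Local Notation k2 := (@Ordinal 4 2 isT).
Local Notation k3 := (@Ordinal 4 3 isT).

(** * Scalar products, isometries and the tetrahedron in coordinates *)

Section Tile.
Local Open Scope classical_set_scope.
Local Open Scope ring_scope.
Variable R : realType.
Local Notation space := 'rV[R]_3.
Lemma dotvE (u w : space) :
  dotv u w = u 0 c0 * w 0 c0 + u 0 c1 * w 0 c1 + u 0 c2 * w 0 c2.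
Proof.
rewrite /dotv !big_ord_recl big_ord0 addr0 addrA.
by do ![congr (_ + _)]; congr (u _ _ * w _ _); apply: val_inj.
Qed.

Lemma row3P (u w : space) : u 0 c0 = w 0 c0 -> u 0 c1 = w 0 c1 ->
  u 0 c2 = w 0 c2 -> u = w.
Proof.
move=> e0 e1 e2; apply/rowP => -[[|[|[|//]]] hj].
- by rewrite (_ : Ordinal hj = c0) //; apply: val_inj.
- by rewrite (_ : Ordinal hj = c1) //; apply: val_inj.
- by rewrite (_ : Ordinal hj = c2) //; apply: val_inj.
Qed.

Lemma dotv_mx (u w : space) : dotv u w = (u *m w^T) 0 0.
Proof. by rewrite mxE; apply: eq_bigr => i _; rewrite mxE. Qed.

Lemma dotv_mulmx (u w : space) (M : 'M[R]_3) : dotv (u *m M) w = dotv u (w *m M^T).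
Proof. by rewrite !dotv_mx trmx_mul trmxK mulmxA. Qed.

Lemma dotvC (u w : space) : dotv u w = dotv w u.
Proof. by rewrite !dotvE; ring. Qed.

Lemma dotvDl (u u' w : space) : dotv (u + u') w = dotv u w + dotv u' w.
Proof. by rewrite !dotvE !mxE; ring. Qed.

Lemma dotvBl (u u' w : space) : dotv (u - u') w = dotv u w - dotv u' w.
Proof. by rewrite !dotvE !mxE; ring. Qed.

Lemma dotvBr (u w w' : space) : dotv u (w - w') = dotv u w - dotv u w'.
Proof. by rewrite !dotvE !mxE; ring. Qed.

Lemma dotvZl a (u w : space) : dotv (a *: u) w = a * dotv u w.
Proof. by rewrite !dotvE !mxE; ring. Qed.

Lemma dotvZr a (u w : space) : dotv u (a *: w) = a * dotv u w.
Proof. by rewrite !dotvE !mxE; ring. Qed.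

Lemma dotv_ge0 (u : space) : 0 <= dotv u u.
Proof. by rewrite dotvE -!expr2 !addr_ge0 ?sqr_ge0. Qed.

Lemma dotv_delta (u : space) i : dotv u (delta_mx 0 i) = u 0 i.
Proof.
rewrite /dotv (bigD1 i) //= !mxE !eqxx mulr1 big1 ?addr0 // => j ji.
by rewrite !mxE (negbTE ji) andbF mulr0.
Qed.

Lemma edist_dotv (x y z w : space) : Defs.edist x y = Defs.edist z w ->
  dotv (x - y) (x - y) = dotv (z - w) (z - w).
Proof.
by move=> /(congr1 (fun r => r ^+ 2)); rewrite !sqr_sqrtr ?dotv_ge0.
Qed.

(** By polarization, [f - f 0] preserves scalar products. It thus sends the standard basis to an
    orthonormal one, the rows of [M], and preserves the coordinates of each point. *)
Lemma isometry_affine (f : space -> space) :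
  (forall x y, Defs.edist (f x) (f y) = Defs.edist x y) ->
  exists M : 'M[R]_3, exists t : space,
    M *m M^T = 1%:M /\ forall x, f x = x *m M + t.
Proof.
move=> fd; pose g x := f x - f 0.
have gd x y : dotv (g x) (g y) = dotv x y.
  have h1 := edist_dotv (fd x y); have h2 := edist_dotv (fd x 0).
  have h3 := edist_dotv (fd y 0); move: h1 h2 h3; rewrite /g !subr0.
  rewrite !dotvBl !dotvBr; have := dotvC (f y) (f x); have := dotvC (f 0) (f x).
  by have := dotvC (f 0) (f y); have := dotvC y x; lra.
pose M : 'M[R]_3 := \matrix_(i, j) g (delta_mx 0 i) 0 j.
have MM : M *m M^T = 1%:M.
  apply/matrixP => i j; rewrite !mxE.
  have -> : \sum_k M i k * M^T k j = dotv (g (delta_mx 0 i)) (g (delta_mx 0 j)).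
    by apply: eq_bigr => k _; rewrite !mxE.
  by rewrite gd dotv_delta mxE eqxx eq_sym.
have gM x : g x *m M^T = x.
  apply/rowP => j; rewrite -[RHS]dotv_delta -gd mxE.
  by apply: eq_bigr => k _; rewrite !mxE.
exists M, (f 0); split=> // x; apply/eqP; rewrite -subr_eq; apply/eqP.
by rewrite -[x in RHS]gM -mulmxA (mulmx1C MM) mulmx1.
Qed.

Definition vec (a b c : R) : space := \row_j [:: a; b; c]`_j.

(** The edge from [k1] to [k2], with angle [ga], is parallel to the first axis; reversing that axis
    is a symmetry. *)
Definition vtx (k : 'I_4) : space :=
  [:: vec 0 0 300; vec 177 240 0; vec (- 177) 240 0; vec 0 0 (- 64)]`_k.

(* Inner normals; face k is opposite to vertex k. *)
Definition nrm (k : 'I_4) : space :=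
  [:: vec 0 (- 4) 15; vec 80 59 0; vec (- 80) 59 0; vec 0 (- 5) (- 4)]`_k.

(** The distance to the plane of face [k], positive on the inner side and scaled by the length of
    [nrm k]. *)
Definition face (k : 'I_4) (x : space) : R :=
  [:: 960; 0; 0; 1200]`_k + dotv x (nrm k).

Lemma forall_I4 (P : 'I_4 -> Prop) : P k0 -> P k1 -> P k2 -> P k3 -> forall k, P k.
Proof.
move=> P0 P1 P2 P3 [[|[|[|[|//]]]] hk].
- by rewrite (_ : Ordinal hk = k0) //; apply: val_inj.
- by rewrite (_ : Ordinal hk = k1) //; apply: val_inj.
- by rewrite (_ : Ordinal hk = k2) //; apply: val_inj.
- by rewrite (_ : Ordinal hk = k3) //; apply: val_inj.
Qed.

Lemma sum_I4 (V : zmodType) (F : 'I_4 -> V) :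
  \sum_i F i = F k0 + F k1 + F k2 + F k3.
Proof.
rewrite !big_ord_recl big_ord0 addr0 !addrA.
by do ![congr (_ + _)]; congr F; apply: val_inj.
Qed.

Lemma face0 x : face k0 x = 960 - 4 * x 0 c1 + 15 * x 0 c2.
Proof. by rewrite /face dotvE !mxE /=; ring. Qed.
Lemma face1 x : face k1 x = 80 * x 0 c0 + 59 * x 0 c1.
Proof. by rewrite /face dotvE !mxE /=; ring. Qed.
Lemma face2 x : face k2 x = 59 * x 0 c1 - 80 * x 0 c0.
Proof. by rewrite /face dotvE !mxE /=; ring. Qed.
Lemma face3 x : face k3 x = 1200 - 5 * x 0 c1 - 4 * x 0 c2.
Proof. by rewrite /face dotvE !mxE /=; ring. Qed.

Lemma tetrahedronE x : tetrahedron vtx x <-> forall k, 0 <= face k x.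
Proof.
split.
  move=> [t [t0 t1 ->]].
  have := t0 k0; have := t0 k1; have := t0 k2; have := t0 k3.
  move: t1; rewrite !sum_I4 => t1 t3 t2 t1' t0'; apply: forall_I4.
  - by rewrite face0 !mxE /=; lra.
  - by rewrite face1 !mxE /=; lra.
  - by rewrite face2 !mxE /=; lra.
  - by rewrite face3 !mxE /=; lra.
move=> fx; have := fx k0; have := fx k1; have := fx k2; have := fx k3.
rewrite face0 face1 face2 face3 => f3 f2 f1 f0.
(* Barycentric coordinates: [face k x] divided by the value of [face k] at the vertex [k]. *)
exists (fun k : 'I_4 => [:: face k0 x / (91 * 60); face k1 x / (354 * 80);
  face k2 x / (354 * 80);
  face k3 x / (28 * 52)]`_k); split.
- by apply: forall_I4 => /=; rewrite ?face0 ?face1 ?face2 ?face3; lra.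
- by rewrite sum_I4 /= face0 face1 face2 face3; lra.
- apply: row3P; rewrite sum_I4 !mxE /= face0 face1 face2 face3; lra.
Qed.

End Tile.

(** * Placed copies of the tetrahedron *)

Section Tiling.
Local Open Scope classical_set_scope.
Local Open Scope ring_scope.
Variable R : realType.
Local Notation space := 'rV[R]_3.
(** For orthogonal [M], the inverse of the isometry [x |-> x *m M + t]: it brings a point back to
    the coordinates of the original tetrahedron. *)
Definition place (M : 'M[R]_3) (t x : space) : space := (x - t) *m M^T.

Definition grad (M : 'M[R]_3) k : space := nrm R k *m M.

Lemma face_placeD M t k x y :
  face k (place M t (x + y)) = face k (place M t x) + dotv y (grad M k).
Proof.
rewrite /face /place [x + y]addrC -[y + x - t]addrA mulmxDl dotvDl.
by rewrite (dotv_mulmx y) trmxK /grad; ring.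
Qed.

Lemma continuous_dotv (n : space) : continuous (fun x : space => dotv x n).
Proof.
have -> : (fun x : space => dotv x n) =
  (fun x => x 0 c0 * n 0 c0 + x 0 c1 * n 0 c1 + x 0 c2 * n 0 c2).
  by apply/funext => x; rewrite dotvE.
have coordM j : continuous (fun x : space => x 0 j * n 0 j).
  by move=> x; apply: continuousM; [exact: coord_continuous | exact: cst_continuous].
by move=> x; exact: (continuousD (continuousD (coordM c0 x) (coordM c1 x)) (coordM c2 x)).
Qed.

Lemma continuous_face M t k : continuous (fun x => face k (place M t x)).
Proof.
have -> : (fun x => face k (place M t x)) =
  (fun x => face k (place M t 0) + dotv x (grad M k)).
  by apply/funext => x; rewrite -{1}[x]add0r face_placeD.
move=> x; exact: (continuousD (@cst_continuous space R (face k (place M t 0)) x)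
  (@continuous_dotv (grad M k) x)).
Qed.

Definition placed_tile M t : set space := [set x | forall k, 0 <= face k (place M t x)].

Lemma closed_placed_tile M t : closed (placed_tile M t).
Proof.
have -> : placed_tile M t =
    \bigcap_(k in [set: 'I_4]) (fun x => face k (place M t x)) @^-1` [set y | 0 <= y].
  by apply/seteqP; split=> [x xT k _|x xT k]; exact: xT.
apply: closed_bigI => k _; apply: preimage_closed; last exact: closed_ge.
by move=> x _; exact: continuous_face.
Qed.

Lemma interior_placed_tile M t x :
  (forall k, 0 < face k (place M t x)) -> (placed_tile M t)° x.
Proof.
move=> fx; have near_pos k : \forall y \near x, 0 < face k (place M t y).
  apply: (@continuous_face M t k x [set y | 0 < y]).
  by apply: open_nbhs_nbhs; split; [exact: open_gt | exact: fx].
have : \forall y \near x, forall k, 0 < face k (place M t y).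
  exact: filter_forall near_pos.
by apply: filterS => y fy k; rewrite ltW.
Qed.

Lemma congruent_placed_tile A : congruent (tetrahedron (vtx R)) A ->
  exists M, exists t, M *m M^T = 1%:M /\ A = placed_tile M t.
Proof.
move=> [f /isometry_affine[M [t [MM fE]]] ->]; exists M, t; split=> //.
apply/seteqP; split=> [_ [x /tetrahedronE xT <-] k|x xT].
  by rewrite /place fE addrK -mulmxA MM mulmx1.
exists (place M t x); first exact/tetrahedronE.
by rewrite fE /place -mulmxA (mulmx1C MM) mulmx1 subrK.
Qed.

(* Composing every placement with the inverse of one of them, we may assume
   that the tetrahedron itself is among the tiles. *)
Lemma tiling_placements : tiles_space (tetrahedron (vtx R)) ->
  exists (I : Type) (M : I -> 'M[R]_3) (t : I -> space) (i0 : I),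
  [/\ forall i, M i *m (M i)^T = 1%:M, M i0 = 1%:M, t i0 = 0,
      forall x, exists i, forall k, 0 <= face k (place (M i) (t i) x) &
      forall i j x, (forall k, 0 < face k (place (M i) (t i) x)) ->
        (forall k, 0 < face k (place (M j) (t j) x)) -> i = j].
Proof.
move=> [C [Ccong Ctile]].
have Cplace (i : {A | C A}) : exists Mt : 'M[R]_3 * space,
    Mt.1 *m Mt.1^T = 1%:M /\ sval i = placed_tile Mt.1 Mt.2.
  by have [M [t ?]] := congruent_placed_tile (Ccong _ (svalP i)); exists (M, t).
have [Mt MtP] := choice Cplace.
have cover x : exists i, forall k, 0 <= face k (place (Mt i).1 (Mt i).2 x).
  (* In either alternative of the tiling, [x] lies in the closure of a copy, and copies are
     closed. *)
  have [A CA Ax] : exists2 A, C A & closure A x.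
    have [[A [[CA Ax] _]]|[_ [A [_ [CA _ _ [Ax _] _]]]]] := Ctile x.
      by exists A => //; apply: subset_closure; exact: interior_subset.
    by exists A.
  have [_ /= AE] := MtP (exist _ A CA); exists (exist _ A CA).
  have : closure (placed_tile (Mt (exist _ A CA)).1 (Mt (exist _ A CA)).2) x.
    by rewrite -AE.
  by rewrite -(closure_id _).1 //; exact: closed_placed_tile.
have disj i j x : (forall k, 0 < face k (place (Mt i).1 (Mt i).2 x)) ->
    (forall k, 0 < face k (place (Mt j).1 (Mt j).2 x)) -> i = j.
  move=> /interior_placed_tile; rewrite -(MtP i).2 => ix.
  move=> /interior_placed_tile; rewrite -(MtP j).2 => jx; 
  apply: eq_sig_hprop => [?|]; first exact: Prop_irrelevance.
  (* An interior point excludes the boundary alternative, so uniqueness identifies the two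
     copies. *)
  have [[A [_ AU]]|[noint _]] := Ctile x; last by case: (noint _ (svalP i)).
  by rewrite -[LHS](AU _ (conj (svalP i) ix)) -[RHS](AU _ (conj (svalP j) jx)).
have [i0 _] := cover 0; pose M0 := (Mt i0).1; pose t0 := (Mt i0).2.
have M0M0 : M0 *m M0^T = 1%:M := (MtP i0).1.
pose M i := (Mt i).1 *m M0^T; pose t i := ((Mt i).2 - t0) *m M0^T.
have placeE i x : place (M i) (t i) x = place (Mt i).1 (Mt i).2 (x *m M0 + t0).
  rewrite /place /M /t trmx_mul trmxK mulmxA; congr (_ *m _).
  by rewrite mulmxBl -mulmxA (mulmx1C M0M0) mulmx1 opprB addrA.
exists {A | C A}, M, t, i0; split.
- move=> i; rewrite /M trmx_mul trmxK mulmxA -[_ *m _ *m M0]mulmxA.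
  by rewrite (mulmx1C M0M0) mulmx1 (MtP i).1.
- exact: M0M0.
- by rewrite /t subrr mul0mx.
- by move=> x; have [i ix] := cover (x *m M0 + t0); exists i => k; rewrite placeE.
- move=> i j x ix jx; apply: (disj _ _ (x *m M0 + t0)) => k.
    by rewrite -placeE.
  by rewrite -placeE.
Qed.

End Tiling.

(** * Normals, half-planes and sectors around an edge *)

Section LocalGeometry.
Local Open Scope classical_set_scope.
Local Open Scope ring_scope.
Variable R : realType.
Local Notation space := 'rV[R]_3.
Lemma dotv_grad M k l : M *m M^T = 1%:M ->
  dotv (grad M k) (grad M l) = dotv (nrm R k) (nrm R l).
Proof. by move=> MM; rewrite dotv_mulmx /grad -mulmxA MM mulmx1. Qed.

Lemma cauchy_schwarz (u w : space) : dotv u w ^+ 2 <= dotv u u * dotv w w.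
Proof.
rewrite !dotvE -subr_ge0.
set a := u 0 _; set b := u 0 _; set c := u 0 _.
set d := w 0 _; set e := w 0 _; set f := w 0 _.
(* Lagrange's identity: the difference is the squared length of the cross product. *)
rewrite (_ : _ - _ = (a * e - b * d) ^+ 2 + (a * f - c * d) ^+ 2 +
  (b * f - c * e) ^+ 2); last by ring.
by rewrite !addr_ge0 ?sqr_ge0.
Qed.

Lemma near0_pos (a b : R) : 0 < a -> \forall h \near 0^'+, 0 < a + h * b.
Proof.
move=> a0; have n0 : 0 < `|b| + 1 by rewrite ltr_wpDl.
have h0 := nbhs_right_gt (0 : R).
have h1 : \forall h \near 0^'+, h < a / (`|b| + 1).
  by apply: nbhs_right_lt; exact: divr_gt0.
near=> h; have hp : 0 < h by near: h.
have : h * (`|b| + 1) < a by rewrite -ltr_pdivlMr //; near: h.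
have : h * - b <= h * `|b| by rewrite ler_pM2l // -normrN ler_norm.
by rewrite mulrDr mulr1 mulrN; lra.
Unshelve. all: by end_near. Qed.

Definition direction (phi : R) : space := vec 0 (cos phi) (sin phi).

(** A normal orthogonal to the edge is [r] times [direction (s + pi / 2)]; its half-plane therefore
    begins at the angle [s], which can be chosen in any window of length [2 * pi]. *)
Lemma grad_polar (b : R) (g : space) : g 0 c0 = 0 -> 0 < dotv g g ->
  exists r s, [/\ 0 < r, b <= s < b + 2 * pi, g 0 c1 = - (r * sin s),
    g 0 c2 = r * cos s & forall phi, dotv (direction phi) g = r * sin (phi - s)].
Proof.
move=> g0 gg; have [|r [s [r0 sr cE sE]]] := @polar_from _ b (g 0 c2) (- g 0 c1).
  rewrite -negb_and; apply/negP => /andP[/eqP e2]; rewrite oppr_eq0 => /eqP e1.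
  by move: gg; rewrite dotvE g0 e1 e2 !mulr0 !addr0 ltxx.
exists r, s; split=> //; first by rewrite -sE opprK.
move=> phi; rewrite dotvE !mxE /= cE -[g 0 c1]opprK sE sinB; ring.
Qed.

Lemma gauss_arg_cos (th x y r : R) : gauss_arg th x y -> 0 < r ->
  r ^+ 2 = x ^+ 2 + y ^+ 2 -> r * cos th = x.
Proof.
move=> [r' r'0 [cE sE]] r0 rE; suff -> : r = r' by [].
apply/eqP; rewrite -(@eqrXn2 _ 2) ?ltW // rE -cE -sE !exprMn -mulrDr cos2Dsin2.
by rewrite mulr1.
Qed.

Lemma dotv_nrm :
  [/\ dotv (nrm R k0) (nrm R k0) = 241, dotv (nrm R k1) (nrm R k1) = 241 * 41,
      dotv (nrm R k2) (nrm R k2) = 241 * 41 & dotv (nrm R k3) (nrm R k3) = 41].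
Proof. by split; rewrite dotvE !mxE /=; ring. Qed.

Lemma dotv_nrm_gt0 k : 0 < dotv (nrm R k) (nrm R k).
Proof. by have [e0 e1 e2 e3] := dotv_nrm; move: k; apply: forall_I4; lra. Qed.

(** The lengths of the normals enter through their squares, without square roots; the minus sign is
    there because inner normals make the angle [pi - th]. *)
Definition face_angle (k l : 'I_4) (th : R) := forall r r' : R, 0 < r -> 0 < r' ->
  r ^+ 2 = dotv (nrm R k) (nrm R k) -> r' ^+ 2 = dotv (nrm R l) (nrm R l) ->
  r * r' * cos th = - dotv (nrm R k) (nrm R l).

Lemma face_angleC k l th : face_angle k l th -> face_angle l k th.
Proof. by move=> kl r r' r0 r'0 rE r'E; rewrite mulrC [r * _]mulrC mulrC dotvC kl. Qed.

Lemma face_angle_arg k l th x y : gauss_arg th x y ->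
  - dotv (nrm R k) (nrm R l) = x ->
  dotv (nrm R k) (nrm R k) * dotv (nrm R l) (nrm R l) = x ^+ 2 + y ^+ 2 ->
  face_angle k l th.
Proof.
move=> thP dE nE r r' r0 r'0 rE r'E; rewrite dE.
by apply: (gauss_arg_cos thP); [exact: mulr_gt0 | rewrite exprMn rE r'E].
Qed.

Lemma face_angle_ga : face_angle k0 k3 (ga R).
Proof.
have [e0 _ _ e3] := dotv_nrm.
apply: (face_angle_arg (ga_arg R)); first by rewrite dotvE !mxE /=; ring.
by rewrite e0 e3; ring.
Qed.

Lemma face_angle_edge (k l : 'I_4) : k != l -> exists2 th, edge_angle th & face_angle k l th.
Proof.
have [e0 e1 e2 e3] := dotv_nrm.
have a_al : edge_angle (al R) by rewrite /edge_angle !inE eqxx.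
have a_be : edge_angle (be R) by rewrite /edge_angle !inE eqxx orbT.
have a_ga : edge_angle (ga R) by rewrite /edge_angle !inE eqxx !orbT.
have a_de : edge_angle (de R) by rewrite /edge_angle !inE eqxx !orbT.
have a01 : face_angle k0 k1 (de R).
  apply: (face_angle_arg (de_arg R)); first by rewrite dotvE !mxE /=; ring.
  by rewrite e0 e1; ring.
have a02 : face_angle k0 k2 (de R).
  apply: (face_angle_arg (de_arg R)); first by rewrite dotvE !mxE /=; ring.
  by rewrite e0 e2; ring.
have a03 := face_angle_ga.
have a12 : face_angle k1 k2 (be R).
  apply: (face_angle_arg (be_arg R)); first by rewrite dotvE !mxE /=; ring.
  by rewrite e1 e2; ring.
have a13 : face_angle k1 k3 (al R).
  apply: (face_angle_arg (al_arg R)); first by rewrite dotvE !mxE /=; ring.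
  by rewrite e1 e3; ring.
have a23 : face_angle k2 k3 (al R).
  apply: (face_angle_arg (al_arg R)); first by rewrite dotvE !mxE /=; ring.
  by rewrite e2 e3; ring.
move: k l; apply: forall_I4; apply: forall_I4 => // _.
- by exists (de R).
- by exists (de R).
- by exists (ga R).
- by exists (de R) => //; exact: face_angleC.
- by exists (be R).
- by exists (al R).
- by exists (de R) => //; exact: face_angleC.
- by exists (be R) => //; exact: face_angleC.
- by exists (al R).
- by exists (ga R) => //; exact: face_angleC.
- by exists (al R) => //; exact: face_angleC.
- by exists (al R) => //; exact: face_angleC.
Qed.

(* Two half-planes { sin (phi - s) >= 0 } and { sin (phi - s') >= 0 } whose inner
   normals make the angle pi - th meet in a sector of opening th, which starts
   at s or at s' according to the orientation. *)
Lemma sector_start (s s' th : R) : cos (s - s') = - cos th ->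
  (forall phi, sin (phi - s') = sin (s + th - phi)) \/
  (forall phi, sin (phi - s) = sin (s' + th - phi)).
Proof.
move=> cE; have : (sin (s - s') - sin th) * (sin (s - s') + sin th) = 0.
  by rewrite -subr_sqr !sin2cos2 cE sqrrN subrr.
move=> /eqP; rewrite mulf_eq0 => /orP[/eqP sE|/eqP sE]; [left|right] => phi.
  have {}sE : sin (s - s') = sin th by lra.
  rewrite (_ : phi - s' = (phi - s) + (s - s')); last by ring.
  rewrite (_ : s + th - phi = th - (phi - s)); last by ring.
  by rewrite (sinD (phi - s)) (sinB th) cE sE; ring.
have {}sE : sin (s - s') = - sin th by lra.
rewrite (_ : phi - s = (phi - s') - (s - s')); last by ring.
rewrite (_ : s' + th - phi = th - (phi - s')); last by ring.
by rewrite (sinB (phi - s')) (sinB th) cE sE; ring.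
Qed.

End LocalGeometry.

(** * Local finiteness of the family of tiles *)

Section Packing.
Local Open Scope classical_set_scope.
Local Open Scope ring_scope.
Variable R : realType.
Local Notation space := 'rV[R]_3.
Variables (I : Type) (M : I -> 'M[R]_3) (t : I -> space) (i0 : I).
Local Notation mu i k x := (face k (place (M i) (t i) x)).
Hypothesis MM : forall i, M i *m (M i)^T = 1%:M.
Hypothesis disj : forall i j x,
  (forall k, 0 < mu i k x) -> (forall k, 0 < mu j k x) -> i = j.

Lemma sqr_le_itv (x c : R) : 0 <= c -> (x ^+ 2 <= c ^+ 2) = (- c <= x <= c).
Proof. by move=> cge; rewrite -ler_norml -[RHS]ler_sqr ?nnegrE // real_normK ?num_real. Qed.

Lemma dotv_sub (u w : space) : dotv (u - w) (u - w) =
  (u 0 c0 - w 0 c0) ^+ 2 + (u 0 c1 - w 0 c1) ^+ 2 + (u 0 c2 - w 0 c2) ^+ 2.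
Proof. by rewrite dotvE !mxE -!expr2. Qed.

(* A point of the tetrahedron at distance more than sqrt 1000 from every face. *)
Definition centre : space := vec 0 100 0.
Definition centre_of i : space := centre *m M i + t i.

Lemma mu_shift i k x y : mu i k (x + y) = mu i k x + dotv y (grad (M i) k).
Proof. exact: face_placeD. Qed.

Lemma mu_centre i k : mu i k (centre_of i) = face k centre.
Proof. by rewrite /place /centre_of addrK -mulmxA MM mulmx1. Qed.

(** By Cauchy-Schwarz, a move shorter than [sqrt 1000] from the centre of tile [i] keeps all its
    face functions positive, so the centre of tile [j] would be interior to both tiles. *)
Lemma close_centres i j :
  dotv (centre_of j - centre_of i) (centre_of j - centre_of i) < 1000 -> i = j.
Proof.
move=> ij; apply: (@disj _ _ (centre_of j)) => k; last first.
  by rewrite mu_centre; move: k; apply: forall_I4;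
    rewrite ?(face0, face1, face2, face3) !mxE /=; lra.
rewrite -[centre_of j](subrKC (centre_of i)) mu_shift mu_centre.
have := cauchy_schwarz (centre_of j - centre_of i) (grad (M i) k).
rewrite (dotv_grad _ _ (MM i)); move: ij.
have := dotv_ge0 (centre_of j - centre_of i).
move: (dotv _ (centre_of _ - _)) (dotv _ (grad _ _)) => z w z0 zlt.
have [e0 e1 e2 e3] := dotv_nrm R.
have key (a b : R) : 0 < b -> 1000 * a < b ^+ 2 -> 0 <= a ->
    w ^+ 2 <= z * a -> 0 < b + w.
  move=> b0 ab a0 wz; rewrite ltNge; apply/negP => bw.
  have w2 : b ^+ 2 <= w ^+ 2 by nra.
  have za : z * a <= 1000 * a by rewrite ler_wpM2r // ltW.
  by lra.
move: k; apply: forall_I4; rewrite ?(e0, e1, e2, e3);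
  rewrite ?(face0, face1, face2, face3) !mxE /=; apply: key; lra.
Qed.

Lemma tile_bounded i x : (forall k, 0 <= mu i k x) ->
  dotv (x - centre_of i) (x - centre_of i) <= 400 ^+ 2.
Proof.
move=> xi; have : x - centre_of i = (place (M i) (t i) x - centre) *m M i.
  rewrite /place /centre_of mulmxBl -mulmxA (mulmx1C (MM i)) mulmx1.
  by rewrite opprD addrA addrAC.
move=> ->; rewrite dotv_mulmx -mulmxA MM mulmx1.
have := xi k0; have := xi k1; have := xi k2; have := xi k3.
move: (place _ _ x) => y; rewrite face0 face1 face2 face3 => f3 f2 f1 f0.
rewrite dotvE !mxE /=.
move: (y 0 c0) (y 0 c1) (y 0 c2) f0 f1 f2 f3 => y0 y1 y2 f0 f1 f2 f3.
have sq (a b : R) : 0 <= b -> - b <= a <= b -> a * a <= b * b.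
  by move=> b0 ab; rewrite -!expr2 sqr_le_itv.
(* A box around the tetrahedron: [177 ^ 2 + 140 ^ 2 + 300 ^ 2 = 140929] is below [400 ^ 2]. *)
have h0 : - 177 <= y0 <= 177 by apply/andP; split; lra.
have h1 : - 140 <= y1 - 100 <= 140 by apply/andP; split; lra.
have h2 : - 300 <= y2 <= 300 by apply/andP; split; lra.
clear f0 f1 f2 f3; rewrite !subr0.
have := sq _ _ (ler0n _ _) h0; have := sq _ _ (ler0n _ _) h1.
by have := sq _ _ (ler0n _ _) h2; lra.
Qed.

(* Every tile that comes close to the midpoint of the chosen edge is central. *)
Definition central i := forall j, - 1000 <= centre_of i 0 j <= 1000.

(* Distinct tiles have centres in distinct cells of a grid of mesh 10, because the
   diagonal of a cell is shorter than sqrt 1000. *)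
Definition cell_coord i j : 'I_202 := inord (Num.truncn (centre_of i 0 j / 10 + 100)).

Definition cell i := (cell_coord i c0, cell_coord i c1, cell_coord i c2).

Lemma cell_coord_close i j m : central i -> central j ->
  cell_coord i m = cell_coord j m -> (centre_of j 0 m - centre_of i 0 m) ^+ 2 <= 10 ^+ 2.
Proof.
move=> /(_ m)/andP[i1 i2] /(_ m)/andP[j1 j2] /(congr1 val) /=.
have bound (a : R) : -1000 <= a -> a <= 1000 ->
    ((Num.truncn (a / 10 + 100)) < 202)%N /\
    (Num.truncn (a / 10 + 100))%:R <= a / 10 + 100
      < (Num.truncn (a / 10 + 100)).+1%:R.
  move=> a1 a2; have a0 : 0 <= a / 10 + 100 by lra.
  have /andP[n1 n2] := truncn_itv a0; split; last exact/andP.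
  by rewrite -(ltr_nat R); apply: le_lt_trans n1 _; lra.
have [ni /andP[i3 i4]] := bound _ i1 i2; have [nj /andP[j3 j4]] := bound _ j1 j2.
rewrite !inordK // => e; move: i3 i4 j3 j4; rewrite e.
move: (Num.truncn _) => n; rewrite -[n.+1%:R]natr1.
move: (centre_of i 0 m) (centre_of j 0 m) (n%:R) => a b c a1 a2 b1 b2.
by rewrite sqr_le_itv //; apply/andP; split; lra.
Qed.

Lemma cell_inj i j : central i -> central j -> cell i = cell j -> i = j.
Proof.
move=> ci cj [e0 e1 e2]; apply: close_centres; rewrite dotv_sub.
have := cell_coord_close ci cj e0; have := cell_coord_close ci cj e1.
have := cell_coord_close ci cj e2; lra.
Qed.

(* The midpoint of the edge with dihedral angle ga. *)
Definition base : space := vec 0 240 0.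

(** Tiles that meet a small box around [base] are central, and a central tile is determined by its
    cell. *)
Lemma finite_near : exists (K : finType) (F : K -> I), forall i (x : space),
  (forall j, (x 0 j - base 0 j) ^+ 2 <= 2 ^+ 2) -> (forall k, 0 <= mu i k x) ->
  exists c, F c = i.
Proof.
exists ('I_202 * 'I_202 * 'I_202)%type.
(* Each cell is sent to its central tile; [i0] is the default for cells without one. *)
exists (fun c => if pselect (exists i, central i /\ cell i = c) is left e
  then sval (cid e) else i0) => i x xb xi; exists (cell i).
have ci : central i.
  move=> j; have := tile_bounded xi; rewrite dotv_sub => b400.
  have : (x 0 j - centre_of i 0 j) ^+ 2 <= 400 ^+ 2.
    have s0 := sqr_ge0 (x 0 c0 - centre_of i 0 c0).
    have s1 := sqr_ge0 (x 0 c1 - centre_of i 0 c1).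
    have s2 := sqr_ge0 (x 0 c2 - centre_of i 0 c2).
    move: j {xb}; case=> [[|[|[|//]]] hj].
    - by rewrite (_ : Ordinal hj = c0); [lra | exact: val_inj].
    - by rewrite (_ : Ordinal hj = c1); [lra | exact: val_inj].
    - by rewrite (_ : Ordinal hj = c2); [lra | exact: val_inj].
  have := xb j; have : 0 <= base 0 j <= 240.
    by rewrite mxE; case: j {xb} => [[|[|[|//]]] hj] /=; lra.
  move: (base 0 j) (x 0 j) (centre_of i 0 j) => a b c /andP[a0 a1] h1 h2.
  move: h1 h2; rewrite !(sqr_le_itv _ (ler0n R _)) => /andP[? ?] /andP[? ?].
  by apply/andP; split; lra.
case: pselect => [e|[]]; last by exists i.
by case: cid => j /= [cj] /(cell_inj cj ci).
Qed.

End Packing.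

(** * The tiles around a generic point of the edge *)

Section GenericPoint.
Local Open Scope classical_set_scope.
Local Open Scope ring_scope.
Variable R : realType.
Local Notation space := 'rV[R]_3.
Variables (I : Type) (M : I -> 'M[R]_3) (t : I -> space).
Local Notation mu i k x := (face k (place (M i) (t i) x)).
Hypothesis MM : forall i, M i *m (M i)^T = 1%:M.
Hypothesis cover : forall x, exists i, forall k, 0 <= mu i k x.
Hypothesis disj : forall i j x,
  (forall k, 0 < mu i k x) -> (forall k, 0 < mu j k x) -> i = j.
Variables (K : finType) (F : K -> I).
Hypothesis F_near : forall i (x : space),
  (forall j, (x 0 j - base R 0 j) ^+ 2 <= 2 ^+ 2) -> (forall k, 0 <= mu i k x) ->
  exists c, F c = i.

Definition edge_point (tau : R) : space := vec tau 240 0.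

Lemma mu_line i k x y h : mu i k (x + h *: y) = mu i k x + h * dotv y (grad (M i) k).
Proof. by rewrite face_placeD dotvZl. Qed.

(* A face that contains a generic point of the edge is parallel to the edge. *)
Lemma generic_edge_point : exists2 tau : R, 0 < tau < 1 &
  forall c k, mu (F c) k (edge_point tau) = 0 -> grad (M (F c)) k 0 c0 = 0.
Proof.
have E tau i k : mu i k (edge_point tau) = mu i k (base R) + tau * grad (M i) k 0 c0.
  rewrite -dotv_delta dotvC -mu_line; congr (face _ (place _ _ _)).
  by apply: row3P; rewrite !mxE /= ?mulr0 ?mulr1 ?addr0 ?add0r.
have near_generic (ck : K * 'I_4) : \forall tau \near (0 : R)^'+,
    mu (F ck.1) ck.2 (edge_point tau) = 0 -> grad (M (F ck.1)) ck.2 0 c0 = 0.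
  case: ck => c k /=; have [->|g0] := eqVneq (grad (M (F c)) k 0 c0) 0.
    by near=> tau.
  have tau0 := nbhs_right_gt (0 : R).
  set a := mu (F c) k (base R); set g := grad _ _ _ _.
  (* A face not parallel to the edge meets its line at the single parameter [- a / g], which small
     positive [tau] avoid. *)
  have root_of tau : mu (F c) k (edge_point tau) = 0 -> tau = - a / g.
    rewrite E -/a -/g => /eqP; rewrite addrC addr_eq0 => /eqP <-.
    by rewrite mulfK.
  have [ag|ag] := leP (- a / g) 0.
    near=> tau => /root_of tauE; have : 0 < tau by near: tau.
    by rewrite tauE ltNge ag.
  near=> tau => /root_of tauE; have : tau < - a / g.
    by near: tau; exact: nbhs_right_lt.
  by rewrite tauE ltxx.
have tau0 := nbhs_right_gt (0 : R).
have tau1 : \forall tau \near (0 : R)^'+, tau < 1 by apply: nbhs_right_lt.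
have gen : \forall tau \near (0 : R)^'+, forall ck : K * 'I_4,
    mu (F ck.1) ck.2 (edge_point tau) = 0 -> grad (M (F ck.1)) ck.2 0 c0 = 0.
  exact: filter_forall near_generic.
near (0 : R)^'+ => tau; have t3 : forall ck : K * 'I_4,
    mu (F ck.1) ck.2 (edge_point tau) = 0 -> grad (M (F ck.1)) ck.2 0 c0 = 0.
  by near: tau.
exists tau; first by apply/andP; split; near: tau.
by move=> c k; exact: (t3 (c, k)).
Unshelve. all: by end_near. Qed.

Section AtPoint.
Variable tau : R.
Hypothesis tau01 : 0 < tau < 1.
Local Notation p := (edge_point tau).
Hypothesis generic : forall c k, mu (F c) k p = 0 -> grad (M (F c)) k 0 c0 = 0.

Definition touches i := forall k, 0 <= mu i k p.
(** Only the faces through [p] constrain a tile near [p]; the cone is taken in the plane through [p]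
    orthogonal to the edge. *)
Definition in_cone i phi := forall k, mu i k p = 0 ->
  0 <= dotv (direction phi) (grad (M i) k).
Definition in_open_cone i phi := forall k, mu i k p = 0 ->
  0 < dotv (direction phi) (grad (M i) k).

(** Some tile contains [p + h *: direction phi]. For small [h] it is one of the finitely many [F c],
    and it contains [p] because tiles missing [p] also miss nearby points on the ray. *)
Lemma cones_cover phi : exists c, touches (F c) /\ in_cone (F c) phi.
Proof.
have h0 := nbhs_right_gt (0 : R).
have h1 : \forall h \near (0 : R)^'+, h < 1 by apply: nbhs_right_lt.
have away c : \forall h \near (0 : R)^'+,
    (forall k, 0 <= mu (F c) k (p + h *: direction phi)) -> touches (F c).
  have [tc|] := pselect (touches (F c)); first by near=> h.
  move=> /existsNP[k /negP]; rewrite -ltNge => mk.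
  have neg := near0_pos (- dotv (direction phi) (grad (M (F c)) k))
    (etrans (oppr_gt0 _) mk).
  near=> h => /(_ k); rewrite mu_line => mh.
  have : 0 < - mu (F c) k p + h * - dotv (direction phi) (grad (M (F c)) k).
    by near: h.
  by rewrite mulrN; lra.
have awayF : \forall h \near (0 : R)^'+, forall c,
    (forall k, 0 <= mu (F c) k (p + h *: direction phi)) -> touches (F c).
  exact: filter_forall away.
near (0 : R)^'+ => h; have hp : 0 < h by near: h.
have h2 : h < 1 by near: h.
have h3 : forall c, (forall k, 0 <= mu (F c) k (p + h *: direction phi)) ->
    touches (F c) by near: h.
have [i ih] := cover (p + h *: direction phi).
have [|c cE] := F_near _ ih.
  move=> j; rewrite sqr_le_itv ?ler0n // !mxE.
  have := cos_le1 phi; have := cos_geN1 phi.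
  have := sin_le1 phi; have := sin_geN1 phi; have /andP[t1 t2] := tau01.
  move: (cos phi) (sin phi) => c s s1 s2 cc1 cc2; case: j => [[|[|[|//]]] hj] /=.
  - by apply/andP; split; lra.
  - by apply/andP; split; nra.
  - by apply/andP; split; nra.
have tc : touches (F c) by apply: h3 => k; rewrite cE.
exists c; split=> // k mk; have := ih k.
by rewrite -cE mu_line mk add0r pmulr_rge0.
Unshelve. all: by end_near. Qed.

(** A direction in both open cones leads to points interior to both tiles. *)
Lemma open_cones_disj i j phi : touches i -> touches j ->
  in_open_cone i phi -> in_open_cone j phi -> i = j.
Proof.
move=> ti tj oi oj; have h0 := nbhs_right_gt (0 : R).
have inside l : touches l -> in_open_cone l phi -> \forall h \near (0 : R)^'+,
    forall k, 0 < mu l k (p + h *: direction phi).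
  move=> tl ol; apply: filter_forall => k.
  have := tl k; rewrite le0r => /orP[/eqP mk|mk].
    near=> h; rewrite mu_line mk add0r pmulr_rgt0; first exact: ol.
    by near: h.
  have := near0_pos (dotv (direction phi) (grad (M l) k)) mk.
  by apply: filterS => h; rewrite mu_line.
near (0 : R)^'+ => h; apply: (@disj _ _ (p + h *: direction phi)); near: h.
  exact: inside.
exact: inside.
Unshelve. all: by end_near. Qed.

Lemma grad_norm i k : dotv (grad (M i) k) (grad (M i) k) = dotv (nrm R k) (nrm R k).
Proof. exact: dotv_grad. Qed.

(** The two inclusions have the form of the hypotheses [clP] and [opP] on arcs. *)
Definition is_arc i s th := (forall phi, in_cone i phi ->
    0 <= sin (phi - s) /\ 0 <= sin (s + th - phi)) /\
  (forall phi, 0 < sin (phi - s) -> 0 < sin (s + th - phi) -> in_open_cone i phi).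

Lemma face_arc (b : R) c (k : 'I_4) : (forall m, (mu (F c) m p == 0) = (m == k)) ->
  exists2 s : R, b <= s < b + 2 * pi & is_arc (F c) s pi.
Proof.
move=> zE; have mk : mu (F c) k p = 0 by apply/eqP; rewrite zE.
have [|r [s [r0 sb _ _ sE]]] := @grad_polar _ b _ (generic mk).
  by rewrite grad_norm dotv_nrm_gt0.
(* For a half-plane the conditions at the two ends of the arc coincide. *)
have piE phi : sin (s + pi - phi) = sin (phi - s).
  rewrite (_ : s + pi - phi = - (phi - s) + pi); last by ring.
  by rewrite sin_pi sinN opprK.
exists s => //; split=> phi; rewrite piE.
  by move=> /(_ k mk); rewrite sE pmulr_rge0.
by move=> s1 _ m /eqP; rewrite zE => /eqP->; rewrite sE mulr_gt0.
Qed.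

(** Both normals are orthogonal to the edge, so their scalar product, unchanged by the placement,
    gives the angle [pi - th] between them in the plane of directions, and [sector_start]
    applies. *)
Lemma edge_arc (b : R) c (k l : 'I_4) th :
  (forall m, (mu (F c) m p == 0) = (m == k) || (m == l)) -> face_angle k l th ->
  exists2 s : R, b <= s < b + 2 * pi & is_arc (F c) s th.
Proof.
move=> zE klth.
have mk : mu (F c) k p = 0 by apply/eqP; rewrite zE eqxx.
have ml : mu (F c) l p = 0 by apply/eqP; rewrite zE eqxx orbT.
have [|r [s [r0 sb g1 g2 sE]]] := @grad_polar _ b _ (generic mk).
  by rewrite grad_norm dotv_nrm_gt0.
have [|r' [s' [r'0 sb' g1' g2' sE']]] := @grad_polar _ b _ (generic ml).
  by rewrite grad_norm dotv_nrm_gt0.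
have cE : cos (s - s') = - cos th.
  have rr0 : r * r' != 0 by rewrite gt_eqF ?mulr_gt0.
  apply: (mulfI rr0); rewrite mulrN klth ?opprK //.
  - rewrite -(dotv_grad _ _ (MM (F c))) dotvE (generic mk) (generic ml).
    by rewrite g1 g2 g1' g2' cosB; ring.
  - rewrite -(dotv_grad _ _ (MM (F c))) dotvE (generic mk) g1 g2.
    by rewrite mul0r add0r mulrNN -!expr2 !exprMn -mulrDr addrC cos2Dsin2 mulr1.
  - rewrite -(dotv_grad _ _ (MM (F c))) dotvE (generic ml) g1' g2'.
    by rewrite mul0r add0r mulrNN -!expr2 !exprMn -mulrDr addrC cos2Dsin2 mulr1.
have [thE|thE] := sector_start cE.
  exists s => //; split=> phi; rewrite -thE.
    by move=> co; have := co k mk; have := co l ml; rewrite sE sE' !pmulr_rge0.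
  by move=> s1 s2 m /eqP; rewrite zE => /orP[]/eqP->; rewrite ?sE ?sE' mulr_gt0.
exists s' => //; split=> phi; rewrite -thE.
  by move=> co; have := co k mk; have := co l ml; rewrite sE sE' !pmulr_rge0.
by move=> s1 s2 m /eqP; rewrite zE => /orP[]/eqP->; rewrite ?sE ?sE' mulr_gt0.
Qed.

(** The edge direction, pulled back to a unit vector [u], would be orthogonal to three normals of
    the tetrahedron, any three of which are linearly independent. *)
Lemma three_faces c (k l m : 'I_4) : k != l -> k != m -> l != m ->
  mu (F c) k p = 0 -> mu (F c) l p = 0 -> mu (F c) m p = 0 -> False.
Proof.
pose u : space := delta_mx 0 c0 *m (M (F c))^T.
have uu : dotv u u = 1.
  by rewrite dotv_mulmx trmxK -mulmxA (mulmx1C (MM _)) mulmx1 dotv_delta mxE !eqxx.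
have un n : mu (F c) n p = 0 -> dotv u (nrm R n) = 0.
  move=> /generic g0; rewrite dotv_mulmx trmxK dotvC dotv_delta; exact: g0.
have zero : u 0 c0 = 0 -> u 0 c1 = 0 -> u 0 c2 = 0 -> False.
  move=> u0 u1 u2; move: uu; rewrite dotvE u0 u1 u2 !mulr0 !addr0 => /eqP.
  by rewrite eq_sym oner_eq0.
move: k l m; clearbody u; do 3!apply: forall_I4 => //; move=> _ _ _ /un + /un + /un;
  rewrite !dotvE !mxE /= => e1 e2 e3; apply: zero; lra.
Qed.

End AtPoint.
End GenericPoint.

(** * Impossibility of a tiling *)

Section NoTiling.
Local Open Scope classical_set_scope.
Local Open Scope ring_scope.
Variable R : realType.
Local Notation space := 'rV[R]_3.
Lemma no_tiling : ~ tiles_space (tetrahedron (vtx R)).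
Proof.
move=> /tiling_placements[I [M [t [i0 [MM M0 t0 cover disj]]]]].
have [K [F F_near]] := finite_near i0 MM disj.
have [tau tau01 generic] := generic_edge_point M t F.
pose T i := touches M t tau i; pose cl i := in_cone M t tau i.
pose op i := in_open_cone M t tau i.
have pi0 := @pi_gt0 R; have /andP[ga1 ga2] := ga_itv R.
have indexed i : T i -> exists c, F c = i.
  move=> Ti; apply: (F_near i (edge_point tau)) Ti => j.
  have /andP[t1 t2] := tau01.
  rewrite (sqr_le_itv _ (ler0n R _)) !mxE.
  by case: j => [[|[|[|//]]] hj] /=; apply/andP; split; lra.
(* In the tile [i0], the point lies exactly on the faces [k0] and [k3], which meet at the angle
   [ga]. *)
have z0 m : (face m (place (M i0) (t i0) (edge_point tau)) == 0) =
    (m == k0) || (m == k3).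
  have /andP[t1 t2] := tau01; rewrite M0 t0 /place subr0 trmx1 mulmx1.
  move: m; apply: forall_I4; rewrite ?(face0, face1, face2, face3) !mxE /=.
  - by transitivity true => //; apply/eqP; lra.
  - by transitivity false => //; apply: gt_eqF; lra.
  - by transitivity false => //; apply: gt_eqF; lra.
  - by transitivity true => //; apply/eqP; lra.
have T0 : T i0.
  have /andP[t1 t2] := tau01; rewrite /T /touches M0 t0 /place subr0 trmx1 mulmx1.
  by apply: forall_I4; rewrite ?(face0, face1, face2, face3) !mxE /=; lra.
have [s0 _ arc0] : exists2 s0 : R, 0 <= s0 < 0 + 2 * pi & is_arc M t tau i0 s0 (ga R).
  have [c cE] := indexed _ T0; rewrite -cE.
  by apply: (edge_arc MM generic 0 _ (@face_angle_ga R)) => m; rewrite cE.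
(* All arcs are made to start in the window that begins at the arc of [i0]. *)
pose arc_data i (st : R * R) := [/\ s0 <= st.1 < s0 + 2 * pi,
  is_arc M t tau i st.1 st.2, edge_angle st.2 \/ st.2 = pi &
  i = i0 -> st.2 = ga R /\ st.1 = s0].
have arcs i : exists st : R * R, T i -> arc_data i st.
  have [->|ii0] := pselect (i = i0).
    exists (s0, ga R) => _; split=> //=; last first.
      by left; rewrite /edge_angle !inE eqxx !orbT.
    by apply/andP; split; lra.
  have [Ti|] := pselect (T i); last by exists (0, 0).
  have [c cE] := indexed _ Ti.
  pose z m := face m (place (M i) (t i) (edge_point tau)) == 0.
  have sector (k l : 'I_4) : k != l -> (forall m, z m = (m == k) || (m == l)) ->
      exists st : R * R, T i -> arc_data i st.
    move=> kl zkl; have [th the klth] := face_angle_edge R kl.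
    have [s sb sP] : exists2 s : R, s0 <= s < s0 + 2 * pi & is_arc M t tau i s th.
      rewrite -cE; apply: (edge_arc MM generic s0 _ klth) => m.
      by rewrite cE; exact: zkl.
    by exists (s, th) => _; split => //=; left.
  have half (k : 'I_4) : (forall m, z m = (m == k)) ->
      exists st : R * R, T i -> arc_data i st.
    move=> zk.
    have [s sb sP] : exists2 s : R, s0 <= s < s0 + 2 * pi & is_arc M t tau i s pi.
      by rewrite -cE; apply: (face_arc MM generic s0) => m; rewrite cE; exact: zk.
    by exists (s, pi) => _; split => //=; right.
  (* Without a face through the point, the open cone is the whole circle and meets that of [i0]. *)
  have zero_face : ~ (forall m, z m = false).
    move=> zN; apply: ii0.
    apply: (open_cones_disj disj Ti T0 (phi := s0 + ga R / 2)).
      by move=> m /eqP; rewrite -/(z m) zN.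
    by apply: arc0.2; apply: sin_gt0_pi; apply/andP; split; lra.
  have many (k l m : 'I_4) : k != l -> k != m -> l != m -> z k -> z l -> z m -> False.
    move=> kl km lm /eqP zk /eqP zl /eqP zm.
    by apply: (@three_faces _ _ _ _ MM _ _ _ generic c k l m); rewrite ?cE.
  (* Among the sixteen sets of faces through the point, three or more faces are impossible, two give
     a wedge, one gives a half-plane. *)
  case z0E: (z k0); case z1E: (z k1); case z2E: (z k2); case z3E: (z k3).
  all: try by case: (many k0 k1 k2).
  all: try by case: (many k0 k1 k3).
  all: try by case: (many k0 k2 k3).
  all: try by case: (many k1 k2 k3).
  all: try by apply: (sector k0 k1) => //; apply: forall_I4.
  all: try by apply: (sector k0 k2) => //; apply: forall_I4.
  all: try by apply: (sector k0 k3) => //; apply: forall_I4.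
  all: try by apply: (sector k1 k2) => //; apply: forall_I4.
  all: try by apply: (sector k1 k3) => //; apply: forall_I4.
  all: try by apply: (sector k2 k3) => //; apply: forall_I4.
  all: try by apply: (half k0); apply: forall_I4.
  all: try by apply: (half k1); apply: forall_I4.
  all: try by apply: (half k2); apply: forall_I4.
  all: try by apply: (half k3); apply: forall_I4.
  by case: zero_face; apply: forall_I4.
have [st stP] := choice arcs.
have st_i0 : (st i0).2 = ga R /\ (st i0).1 = s0.
  by have [_ _ _] := stP _ T0; apply.
have [l lP lE] : exists2 l : seq R, (forall x, x \in l -> exists2 i, T i & (st i).2 = x) &
    (st i0).2 + \sum_(x <- l) x = 2 * pi.
  apply: (@arc_chain R I K F T (fun i => (st i).1) (fun i => (st i).2) cl op i0 (pi / 3)).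
  - exact: T0.
  - lra.
  - by move=> i Ti; rewrite st_i0.2; have [] := stP _ Ti.
  - move=> i Ti; have [_ _ + _] := stP _ Ti.
    by case=> [/edge_angle_itv/andP[? ?]|->]; apply/andP; split; lra.
  - by move=> phi; apply: (cones_cover cover F_near tau01).
  - by move=> i phi Ti ci; have [_ [+ _] _ _] := stP _ Ti; apply.
  - by move=> i phi Ti; have [_ [_ +] _ _] := stP _ Ti; apply.
  - by move=> i j phi Ti Tj; exact: (open_cones_disj disj Ti Tj).
move: lE; rewrite st_i0.1; apply: angle_sum_neq => x /lP[i Ti <-].
by have [] := stP _ Ti.
Qed.

End NoTiling.

(** * Edge lengths, dihedral angles and the Dehn invariant *)

Section Dehn.
Local Open Scope classical_set_scope.
Local Open Scope ring_scope.
Local Open Scope quotient_scope.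
Variable R : realType.
Local Notation space := 'rV[R]_3.
Lemma enum_I4 : enum 'I_4 = [:: k0; k1; k2; k3].
Proof. by apply: (inj_map val_inj); rewrite val_enum_ord. Qed.

Lemma dotv_orthopart (e u w : space) : 0 < dotv e e ->
  dotv (orthopart e u) (orthopart e w) =
  (dotv u w * dotv e e - dotv u e * dotv w e) / dotv e e.
Proof.
move=> ee; rewrite /orthopart !(dotvBl, dotvBr, dotvZl, dotvZr).
by rewrite (dotvC e w); field; rewrite gt_eqF.
Qed.

(** Clears the denominators of the projections and the square roots, so that a dihedral angle
    reduces to polynomial identities in six scalar products. *)
Lemma vangle_orthopart (e u w : space) (k x y : R) :
  0 < dotv e e -> 0 < k ->
  dotv u w * dotv e e - dotv u e * dotv w e = k * x ->
  (dotv u u * dotv e e - dotv u e * dotv u e) *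
    (dotv w w * dotv e e - dotv w e * dotv w e) = k ^+ 2 * (x ^+ 2 + y ^+ 2) ->
  vangle (orthopart e u) (orthopart e w) = gauss_angle x y.
Proof.
move=> ee kp uwE uuwwE; rewrite /vangle /gauss_angle /enorm.
rewrite -sqrtrM ?dotv_ge0 // !dotv_orthopart // uwE.
have sqE : k ^+ 2 * (x ^+ 2 + y ^+ 2) * ((dotv e e)^-1 * (dotv e e)^-1) =
    (k / dotv e e) ^+ 2 * (x ^+ 2 + y ^+ 2) by field; rewrite gt_eqF.
rewrite mulrACA uuwwE sqE.
have ke0 : 0 < k / dotv e e by exact: divr_gt0.
rewrite sqrtrM ?sqr_ge0 // sqrtr_sqr gtr0_norm //; congr acos.
by rewrite [k * x / _]mulrAC -mulf_div divff ?mul1r // gt_eqF.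
Qed.

Lemma edge_lengthE i j (n : nat) :
  dotv (vtx R i - vtx R j) (vtx R i - vtx R j) = n%:R ^+ 2 ->
  edge_length (vtx R) i j = n%:R.
Proof.
by move=> nE; rewrite /edge_length /Defs.edist /enorm nE sqrtr_sqr ger0_norm.
Qed.

Lemma dihedral01 : dihedral_angle (vtx R) k0 k1 = al R.
Proof.
rewrite /dihedral_angle /other_vertices enum_I4 /=.
set e := vtx R _ - _; set u := vtx R _ - _; set w := vtx R _ - _.
have ee : dotv e e = (178 * 1000 + 929) by rewrite dotvE !mxE /=; ring.
have uu : dotv u u = (178 * 1000 + 929) by rewrite dotvE !mxE /=; ring.
have ww : dotv w w = (132 * 1000 + 496) by rewrite dotvE !mxE /=; ring.
have ue : dotv u e = (116 * 1000 + 271) by rewrite dotvE !mxE /=; ring.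
have we : dotv w e = (109 * 1000 + 200) by rewrite dotvE !mxE /=; ring.
have uw : dotv u w = (109 * 1000 + 200) by rewrite dotvE !mxE /=; ring.
(* The factor is [(109200 * 178929 - 116271 * 109200) / 295], with [295] the real part of the number
   for [al]. *)
apply: (@vangle_orthopart _ _ _ (864 * 455 * 59)); rewrite ?ee ?uu ?ww ?ue ?we ?uw;
  by [lra | ring].
Qed.

Lemma dihedral02 : dihedral_angle (vtx R) k0 k2 = al R.
Proof.
rewrite /dihedral_angle /other_vertices enum_I4 /=.
set e := vtx R _ - _; set u := vtx R _ - _; set w := vtx R _ - _.
have ee : dotv e e = (178 * 1000 + 929) by rewrite dotvE !mxE /=; ring.
have uu : dotv u u = (178 * 1000 + 929) by rewrite dotvE !mxE /=; ring.
have ww : dotv w w = (132 * 1000 + 496) by rewrite dotvE !mxE /=; ring.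
have ue : dotv u e = (116 * 1000 + 271) by rewrite dotvE !mxE /=; ring.
have we : dotv w e = (109 * 1000 + 200) by rewrite dotvE !mxE /=; ring.
have uw : dotv u w = (109 * 1000 + 200) by rewrite dotvE !mxE /=; ring.
apply: (@vangle_orthopart _ _ _ (864 * 455 * 59)); rewrite ?ee ?uu ?ww ?ue ?we ?uw;
  by [lra | ring].
Qed.

Lemma dihedral03 : dihedral_angle (vtx R) k0 k3 = be R.
Proof.
rewrite /dihedral_angle /other_vertices enum_I4 /=.
set e := vtx R _ - _; set u := vtx R _ - _; set w := vtx R _ - _.
have ee : dotv e e = (132 * 1000 + 496) by rewrite dotvE !mxE /=; ring.
have uu : dotv u u = (178 * 1000 + 929) by rewrite dotvE !mxE /=; ring.
have ww : dotv w w = (178 * 1000 + 929) by rewrite dotvE !mxE /=; ring.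
have ue : dotv u e = (109 * 1000 + 200) by rewrite dotvE !mxE /=; ring.
have we : dotv w e = (109 * 1000 + 200) by rewrite dotvE !mxE /=; ring.
have uw : dotv u w = (116 * 1000 + 271) by rewrite dotvE !mxE /=; ring.
apply: (@vangle_orthopart _ _ _ (144 * 49 * 169)); rewrite ?ee ?uu ?ww ?ue ?we ?uw;
  by [lra | ring].
Qed.

Lemma dihedral12 : dihedral_angle (vtx R) k1 k2 = ga R.
Proof.
rewrite /dihedral_angle /other_vertices enum_I4 /=.
set e := vtx R _ - _; set u := vtx R _ - _; set w := vtx R _ - _.
have ee : dotv e e = (125 * 1000 + 316) by rewrite dotvE !mxE /=; ring.
have uu : dotv u u = (178 * 1000 + 929) by rewrite dotvE !mxE /=; ring.
have ww : dotv w w = (93 * 1000 + 25) by rewrite dotvE !mxE /=; ring.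
have ue : dotv u e = (62 * 1000 + 658) by rewrite dotvE !mxE /=; ring.
have we : dotv w e = (62 * 1000 + 658) by rewrite dotvE !mxE /=; ring.
have uw : dotv u w = (69 * 1000 + 729) by rewrite dotvE !mxE /=; ring.
apply: (@vangle_orthopart _ _ _ (3456 * 10 * 59 * 59)); rewrite ?ee ?uu ?ww ?ue ?we ?uw;
  by [lra | ring].
Qed.

Lemma dihedral13 : dihedral_angle (vtx R) k1 k3 = de R.
Proof.
rewrite /dihedral_angle /other_vertices enum_I4 /=.
set e := vtx R _ - _; set u := vtx R _ - _; set w := vtx R _ - _.
have ee : dotv e e = (93 * 1000 + 25) by rewrite dotvE !mxE /=; ring.
have uu : dotv u u = (178 * 1000 + 929) by rewrite dotvE !mxE /=; ring.
have ww : dotv w w = (125 * 1000 + 316) by rewrite dotvE !mxE /=; ring.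
have ue : dotv u e = (69 * 1000 + 729) by rewrite dotvE !mxE /=; ring.
have we : dotv w e = (62 * 1000 + 658) by rewrite dotvE !mxE /=; ring.
have uw : dotv u w = (62 * 1000 + 658) by rewrite dotvE !mxE /=; ring.
apply: (@vangle_orthopart _ _ _ (1152 * 91 * 59)); rewrite ?ee ?uu ?ww ?ue ?we ?uw;
  by [lra | ring].
Qed.

Lemma dihedral23 : dihedral_angle (vtx R) k2 k3 = de R.
Proof.
rewrite /dihedral_angle /other_vertices enum_I4 /=.
set e := vtx R _ - _; set u := vtx R _ - _; set w := vtx R _ - _.
have ee : dotv e e = (93 * 1000 + 25) by rewrite dotvE !mxE /=; ring.
have uu : dotv u u = (178 * 1000 + 929) by rewrite dotvE !mxE /=; ring.
have ww : dotv w w = (125 * 1000 + 316) by rewrite dotvE !mxE /=; ring.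
have ue : dotv u e = (69 * 1000 + 729) by rewrite dotvE !mxE /=; ring.
have we : dotv w e = (62 * 1000 + 658) by rewrite dotvE !mxE /=; ring.
have uw : dotv u w = (62 * 1000 + 658) by rewrite dotvE !mxE /=; ring.
apply: (@vangle_orthopart _ _ _ (1152 * 91 * 59)); rewrite ?ee ?uu ?ww ?ue ?we ?uw;
  by [lra | ring].
Qed.

Lemma length01 : edge_length (vtx R) k0 k1 = 423.
Proof. by apply: edge_lengthE; rewrite dotvE !mxE /=; ring. Qed.

Lemma length02 : edge_length (vtx R) k0 k2 = 423.
Proof. by apply: edge_lengthE; rewrite dotvE !mxE /=; ring. Qed.

Lemma length03 : edge_length (vtx R) k0 k3 = 364.
Proof. by apply: edge_lengthE; rewrite dotvE !mxE /=; ring. Qed.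

Lemma length12 : edge_length (vtx R) k1 k2 = 354.
Proof. by apply: edge_lengthE; rewrite dotvE !mxE /=; ring. Qed.

Lemma length13 : edge_length (vtx R) k1 k3 = 305.
Proof. by apply: edge_lengthE; rewrite dotvE !mxE /=; ring. Qed.

Lemma length23 : edge_length (vtx R) k2 k3 = 305.
Proof. by apply: edge_lengthE; rewrite dotvE !mxE /=; ring. Qed.

Lemma tens_natl (n : nat) (x : R) :
  tens (n%:R : ratmod R) (class_modQpi x) = tens (1 : ratmod R) (class_modQpi (n%:R * x)).
Proof.
have nE : (n%:R : ratmod R) = (n%:R : rat) *: (1 : ratmod R).
  by rewrite [RHS]mulr1 [LHS]/= ratr_nat.
rewrite [X in tens X _ = _]nE tensZ [_ *: class_modQpi x]modQpi_scaleE.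
by rewrite /GRing.scale /= /ratmod_scale ratr_nat.
Qed.

Lemma tens0r (K : comNzRingType) (U V : lmodType K) (u : U) : tens u (0 : V) = 0.
Proof. by apply: (addrI (tens u 0)); rewrite -tensDr !addr0. Qed.

Lemma class_modQpi_pi (n : nat) : class_modQpi (n%:R * pi : R) = 0.
Proof.
apply/eqP; rewrite -[0](raddf0 (\pi_{ideal_quot (@Qpi R)})) -Quotient.idealrBE subr0.
by apply/asboolP; exists n%:R; rewrite /GRing.scale /= /ratmod_scale ratr_nat.
Qed.

Lemma dehn_invariant_vtx : dehn_invariant (vtx R) = 0.
Proof.
rewrite /dehn_invariant sum_I4; do 4!rewrite big_mkcond sum_I4 /=.
rewrite !(add0r, addr0) dihedral01 dihedral02 dihedral03 dihedral12 dihedral13 dihedral23.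
rewrite length01 length02 length03 length12 length13 length23.
rewrite !tens_natl -!tensDr -!class_modQpiD.
(* The sum is [364] times the first angle relation plus [118] times the second, and
   [2 * 364 + 118 = 846]. *)
rewrite (_ : _ + _ = 846%:R * pi); first by rewrite class_modQpi_pi tens0r.
by have := angle_relation1 R; have := angle_relation2 R; lra.
Qed.

Lemma nondegenerate_vtx : nondegenerate_tetrahedron (vtx R).
Proof.
rewrite /nondegenerate_tetrahedron; apply: inj_row_free => x.
move=> xA; set A := (\matrix_i _) in xA.
have xE j : dotv x (\row_i A i j) = 0.
  have <- : (x *m A) 0 j = 0 by rewrite xA mxE.
  by rewrite mxE; apply: eq_bigr => i _; rewrite mxE.
have := xE c0; have := xE c1; have := xE c2.
rewrite !dotvE !mxE /= => e2 e1 e0.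
by apply: row3P; rewrite mxE; lra.
Qed.

End Dehn.

Theorem corollary1p3 (R : realType) :
  exists v : 'I_4 -> 'rV[R]_3,
    [/\ nondegenerate_tetrahedron v, dehn_invariant v = 0 & ~ tiles_space (tetrahedron v)].
Proof.
exists (@vtx R); split.
- exact: nondegenerate_vtx.
- exact: dehn_invariant_vtx.
- exact: no_tiling.
Qed.
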